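(* Let $M^2$ be a PMC surface in a complex space form $N^n(c)$, with nowhere vanishing mean curvature vector field $H$. If $c=0$, then $M^2$ is biconservative. If $c\neq 0$, then $M^2$ is biconservative if and only if $M^2$ is totally real.
   Context: A surface is an oriented manifold of real dimension $2$. A complex space form $N^n(c)$ is a Kähler manifold of complex dimension $n$, with complex structure $J$, and constant holomorphic sectional curvature $c$. Submanifolds $\phi:M^m\to N$ are isometric immersions; $B$ is the second fundamental form, $H=\frac1m\operatorname{trace}B$ the mean curvature vector field, $\nabla^\perp$ the normal connection. $M$ is PMC if $\nabla^\perp H=0$. $M$ is totally real if $J(TM)$ is contained in the normal bundle of $M$. The tension field is $\tau(\phi)=\operatorname{trace}\nabla d\phi=mH$ and the bitension field is $\tau_2(\phi)=-\Delta\tau(\phi)-\operatorname{trace}\overline R(d\phi(\cdot),\tau(\phi))d\phi(\cdot)$, where $\Delta=-\operatorname{trace}\nabla^2$ and $\overline R(X,Y)Z=\overline\nabla_X\overline\nabla_YZ-\overline\nabla_Y\overline\nabla_XZ-\overline\nabla_{[X,Y]}Z$ is the curvature tensor of $N$. $M$ is biconservative if the tangential part of $\tau_2(\phi)$ vanishes (equivalently, the stress-energy tensor of the bienergy is divergence-free). *)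

(* Defs.v *)
From HB Require Import structures.
From mathcomp Require Import all_boot all_order all_algebra.
From mathcomp Require Import all_classical all_reals all_analysis.
Set Implicit Arguments. Unset Strict Implicit. Unset Printing Implicit Defensive.
Import Order.TTheory GRing.Theory Num.Theory.
Import numFieldNormedType.Exports.
Local Open Scope classical_set_scope.
Local Open Scope ring_scope.

(* Manifolds are topological spaces with a smooth atlas, and tensor fields are
   families of component functions, one per chart, related by the tensor
   transformation law.  Tangent vectors are row vectors of components, so that
   the differential of [f] at [x] is [X |-> 'D_X f x = X *m jacobian f x]. *)

Notation "''e_' a" := (delta_mx 0 a : 'rV__)
  (at level 8, a at level 2, format "''e_' a") : ring_scope.

(* [Ck k U f] is meant for open [U].  The partial derivatives being themselves
   continuous, this is the usual class C^k on [U]. *)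
Fixpoint Ck (R : realType) (m : nat) (V : normedModType R) (k : nat)
    (U : set 'rV[R]_m) (f : 'rV[R]_m -> V) : Prop :=
  match k with
  | 0 => forall x, U x -> {for x, continuous f}
  | k'.+1 => (forall x, U x -> differentiable f x) /\
             (forall a : 'I_m, Ck k' U (fun x => 'D_('e_a) f x))
  end.

Definition smooth_on (R : realType) (m : nat) (V : normedModType R)
    (U : set 'rV[R]_m) (f : 'rV[R]_m -> V) : Prop :=
  forall k, Ck k U f.

Section RiemannianCoordinates.
Variables (R : realType) (m : nat).
Implicit Types (g : 'rV[R]_m -> 'M[R]_m) (x : 'rV[R]_m).

Definition inner g x (X Y : 'rV[R]_m) : R := (X *m g x *m Y^T) 0 0.

(* [christoffel g x l i j] is the symbol with upper index [l] *)
Definition christoffel g x (l i j : 'I_m) : R :=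
  2^-1 * \sum_(k < m) invmx (g x) l k *
    ('D_('e_i) (fun y => g y j k) x + 'D_('e_j) (fun y => g y i k) x
     - 'D_('e_k) (fun y => g y i j) x).

Definition gamma g x (X Y : 'rV[R]_m) : 'rV[R]_m :=
  \row_(l < m) \sum_(i < m) \sum_(j < m) christoffel g x l i j * X 0 i * Y 0 j.

Definition nabla g (X Y : 'rV[R]_m -> 'rV[R]_m) x : 'rV[R]_m :=
  'D_(X x) Y x + gamma g x (X x) (Y x).

Definition bracket (X Y : 'rV[R]_m -> 'rV[R]_m) x : 'rV[R]_m :=
  'D_(X x) Y x - 'D_(Y x) X x.

Definition curvature_fields g (X Y Z : 'rV[R]_m -> 'rV[R]_m) x : 'rV[R]_m :=
  nabla g X (nabla g Y Z) x - nabla g Y (nabla g X Z) x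
  - nabla g (bracket X Y) Z x.

(* The curvature is tensorial: on tangent vectors it is computed with the
   extensions having constant components. *)
Definition curvature g x (X Y Z : 'rV[R]_m) : 'rV[R]_m :=
  curvature_fields g (cst X) (cst Y) (cst Z) x.

Definition sectional_curvature g x (X Y : 'rV[R]_m) : R :=
  inner g x (curvature g x X Y Y) X /
  (inner g x X X * inner g x Y Y - inner g x X Y ^+ 2).

Definition trace_wrt (W : lmodType R) g x (T : 'I_m -> 'I_m -> W) : W :=
  \sum_(a < m) \sum_(b < m) invmx (g x) a b *: T a b.

End RiemannianCoordinates.

Section MapsInCoordinates.
Variables (R : realType) (m d : nat).
Variables (g : 'rV[R]_m -> 'M[R]_m) (h : 'rV[R]_d -> 'M[R]_d).
Variable f : 'rV[R]_m -> 'rV[R]_d.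
Implicit Types (V : 'rV[R]_m -> 'rV[R]_d) (x : 'rV[R]_m) (a b : 'I_m).

(* Vector fields along [f] are functions [V] giving components in the target
   chart; this is the pull-back of the Levi-Civita connection of [h]. *)
Definition nabla_along a V x : 'rV[R]_d :=
  'D_('e_a) V x + gamma h (f x) ('D_('e_a) f x) (V x).

Definition nabla2_along V a b x : 'rV[R]_d :=
  nabla_along a (nabla_along b V) x
  - \sum_(k < m) christoffel g x k a b *: nabla_along k V x.

Definition laplacian_along V x : 'rV[R]_d :=
  - trace_wrt g x (fun a b => nabla2_along V a b x).

Definition nabla_df a b x : 'rV[R]_d :=
  nabla_along a (fun y => 'D_('e_b) f y) x
  - \sum_(k < m) christoffel g x k a b *: 'D_('e_k) f x.

(* Gauss formula: the covariant derivative in the ambient space minus the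
   Levi-Civita covariant derivative of the submanifold *)
Definition second_fundamental_form a b x : 'rV[R]_d := nabla_df a b x.

Definition mean_curvature x : 'rV[R]_d :=
  m%:R^-1 *: trace_wrt g x (fun a b => second_fundamental_form a b x).

Definition tension x : 'rV[R]_d := trace_wrt g x (fun a b => nabla_df a b x).

Definition bitension x : 'rV[R]_d :=
  - laplacian_along tension x
  - trace_wrt g x (fun a b =>
      curvature h (f x) ('D_('e_a) f x) (tension x) ('D_('e_b) f x)).

(* [g] is the metric induced by [f], so these are orthogonal projections. *)
Definition tangent_part x (W : 'rV[R]_d) : 'rV[R]_d :=
  trace_wrt g x (fun a b =>
    inner h (f x) W ('D_('e_a) f x) *: 'D_('e_b) f x).

Definition normal_part x (W : 'rV[R]_d) : 'rV[R]_d := W - tangent_part x W.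

Definition nabla_perp a V x : 'rV[R]_d := normal_part x (nabla_along a V x).

Definition normal_bundle x : set 'rV[R]_d :=
  [set W | forall Y : 'rV[R]_m, inner h (f x) W ('D_Y f x) = 0].

End MapsInCoordinates.

Record chart (R : realType) (m : nat) (T : topologicalType) := Chart {
  cdom : set T ;
  cmap : T -> 'rV[R]_m ;
  cinv : 'rV[R]_m -> T ;
  cdom_open : open cdom ;
  cimg_open : open (cmap @` cdom) ;
  cmapK : forall p, cdom p -> cinv (cmap p) = p ;
  cmap_continuous : forall p, cdom p -> {for p, continuous cmap} ;
  cinv_continuous :
    forall x, (cmap @` cdom) x -> {for x, continuous cinv} }.

Definition cimg (R : realType) (m : nat) (T : topologicalType)
    (u : chart R m T) : set 'rV[R]_m := cmap u @` cdom u.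

(* the expression of [phi] in the charts [u] and [v], and its natural domain *)
Definition rep (R : realType) (m d : nat) (T S : topologicalType)
    (u : chart R m T) (v : chart R d S) (phi : T -> S) :
    'rV[R]_m -> 'rV[R]_d := fun x => cmap v (phi (cinv u x)).

Definition repdom (R : realType) (m d : nat) (T S : topologicalType)
    (u : chart R m T) (v : chart R d S) (phi : T -> S) : set 'rV[R]_m :=
  [set x | cimg u x /\ cdom v (phi (cinv u x))].

Record manifold (R : realType) (m : nat) := Manifold {
  carrier :> topologicalType ;
  carrier_hausdorff : hausdorff_space carrier ;
  carrier_second_countable : @second_countable carrier ;
  chart_index : Type ;
  atlas : chart_index -> chart R m carrier ;
  atlas_cover : forall p, exists i, cdom (atlas i) p ;
  atlas_smooth : forall i j,
    smooth_on (repdom (atlas i) (atlas j) id) (rep (atlas i) (atlas j) id) }.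

Record riemannianManifold (R : realType) (m : nat) := RiemannianManifold {
  rmanifold :> manifold R m ;
  metric : chart_index rmanifold -> 'rV[R]_m -> 'M[R]_m ;
  metric_smooth : forall i, smooth_on (cimg (atlas i)) (metric i) ;
  metric_sym : forall i x, cimg (atlas i) x -> (metric i x)^T = metric i x ;
  metric_pos : forall i x, cimg (atlas i) x ->
    forall X : 'rV[R]_m, X != 0 -> 0 < inner (metric i) x X X ;
  metric_transform : forall i j x, repdom (atlas i) (atlas j) id x ->
    metric i x =
      jacobian (rep (atlas i) (atlas j) id) x
      *m metric j (rep (atlas i) (atlas j) id x)
      *m (jacobian (rep (atlas i) (atlas j) id) x)^T }.

(* An oriented manifold is given by an oriented atlas. *)
Definition oriented (R : realType) (m : nat) (M : manifold R m) : Prop :=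
  forall (i j : chart_index M) x, repdom (atlas i) (atlas j) id x ->
    0 < \det (jacobian (rep (atlas i) (atlas j) id) x).

(* Coordinates z_k = x_k + i y_k on C^n are ordered (x_1..x_n, y_1..y_n), and
   [X *m stdJ] is multiplication by i. *)
Definition stdJ (R : realType) (n : nat) : 'M[R]_(n + n) :=
  block_mx 0 1%:M (- 1%:M) 0.

(* The transition maps, already smooth, satisfy the Cauchy-Riemann equations;
   hence the complex structure J has matrix [stdJ] in every chart. *)
Definition complex_manifold (R : realType) (n : nat)
    (N : manifold R (n + n)) : Prop :=
  forall (i j : chart_index N) x, repdom (atlas i) (atlas j) id x ->
    stdJ R n *m jacobian (rep (atlas i) (atlas j) id) x =
    jacobian (rep (atlas i) (atlas j) id) x *m stdJ R n.

Definition hermitian_metric (R : realType) (n : nat)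
    (N : riemannianManifold R (n + n)) : Prop :=
  forall (i : chart_index N) x, cimg (atlas i) x -> forall X Y : 'rV[R]_(n + n),
    inner (metric i) x (X *m stdJ R n) (Y *m stdJ R n) =
    inner (metric i) x X Y.

(* components of the fundamental form omega(X, Y) = g(JX, Y) *)
Definition fundamental_form (R : realType) (n : nat)
    (N : riemannianManifold R (n + n)) (i : chart_index N)
    (a b : 'I_(n + n)) (x : 'rV[R]_(n + n)) : R :=
  inner (metric i) x ('e_a *m stdJ R n) 'e_b.

Definition fundamental_form_closed (R : realType) (n : nat)
    (N : riemannianManifold R (n + n)) : Prop :=
  forall (i : chart_index N) x, cimg (atlas i) x -> forall a b k : 'I_(n + n),
    'D_('e_a) (fundamental_form i b k) x
    + 'D_('e_b) (fundamental_form i k a) x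
    + 'D_('e_k) (fundamental_form i a b) x = 0.

Definition kahler (R : realType) (n : nat)
    (N : riemannianManifold R (n + n)) : Prop :=
  [/\ complex_manifold N, hermitian_metric N & fundamental_form_closed N].

Definition complex_space_form (R : realType) (n : nat) (c : R)
    (N : riemannianManifold R (n + n)) : Prop :=
  kahler N /\
  forall (i : chart_index N) x, cimg (atlas i) x ->
    forall X : 'rV[R]_(n + n), X != 0 ->
      sectional_curvature (metric i) x X (X *m stdJ R n) = c.

(* The notions below do not depend on charts; they are required to hold in
   every pair of charts of the two atlases. *)
Section Submanifolds.
Variables (R : realType) (m d : nat).
Variables (M : riemannianManifold R m) (N : riemannianManifold R d).
Variable phi : M -> N.
Implicit Types (i : chart_index M) (j : chart_index N) (x : 'rV[R]_m).

Let loc i j := rep (atlas i) (atlas j) phi.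
Let dom i j := repdom (atlas i) (atlas j) phi.

(* [phi] is an immersion since [metric i x] is positive definite. *)
Definition isometric_immersion : Prop :=
  [/\ continuous phi,
      forall i j, smooth_on (dom i j) (loc i j)
    & forall i j x, dom i j x -> forall X Y : 'rV[R]_m,
        inner (metric j) (loc i j x) ('D_X (loc i j) x) ('D_Y (loc i j) x) =
        inner (metric i) x X Y].

Definition PMC : Prop :=
  forall i j x, dom i j x -> forall a : 'I_m,
    nabla_perp (metric i) (metric j) (loc i j) a
      (mean_curvature (metric i) (metric j) (loc i j)) x = 0.

Definition nowhere_vanishing_mean_curvature : Prop :=
  forall i j x, dom i j x ->
    mean_curvature (metric i) (metric j) (loc i j) x != 0.

Definition biconservative : Prop :=
  forall i j x, dom i j x ->
    tangent_part (metric i) (metric j) (loc i j) x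
      (bitension (metric i) (metric j) (loc i j) x) = 0.

End Submanifolds.

Definition totally_real (R : realType) (m n : nat)
    (M : riemannianManifold R m) (N : riemannianManifold R (n + n))
    (phi : M -> N) : Prop :=
  forall (i : chart_index M) (j : chart_index N) x, repdom (atlas i) (atlas j) phi x ->
    forall X : 'rV[R]_m,
      normal_bundle (metric j) (rep (atlas i) (atlas j) phi) x
        ('D_X (rep (atlas i) (atlas j) phi) x *m stdJ R n).

(* Main.v *)
From HB Require Import structures.
Require Import Defs.
From mathcomp Require Import all_boot all_order all_algebra.
From mathcomp Require Import all_classical all_reals all_analysis.
From mathcomp Require Import ring lra.
Set Implicit Arguments. Unset Strict Implicit. Unset Printing Implicit Defensive.
Import Order.TTheory GRing.Theory Num.Theory.
Import numFieldNormedType.Exports.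
Local Open Scope classical_set_scope.
Local Open Scope ring_scope.

(** Write [tau] for the tension field, which is twice the mean curvature vector
    [H], and [J] for the complex structure. The statement is local and is proved
    in one chart of the surface and one chart of the ambient space.

    For any PMC submanifold the tangential part of the bitension field is a
    curvature term. Indeed [tau] is normal and its derivatives are tangent, given
    by its shape form (the second fundamental form paired with [tau]), so the
    tangential part of its second derivatives is minus the covariant derivative
    of the shape form. The shape form is symmetric, and the second derivatives
    of [tau] commute up to curvature; hence the tangential part of the rough
    Laplacian is, up to sign, the derivative of the trace of the shape form, plus
    a trace of the ambient curvature. The trace of the shape form is the squared
    length of [tau], which is constant. The other trace coincides, by the
    symmetries of the Riemann tensor, with the explicit curvature term of the
    bitension field ([bitension_tangent]).

    In a complex space form the Riemann tensor is known ([riem_space_form]),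
    because a Kaehler curvature tensor is determined by its holomorphic sectional
    curvatures ([holomorphic_flat_curvature]); its Kaehler symmetries come from
    the fact that [J] is parallel ([gammaJ]), which the closedness of the
    fundamental form implies. The trace above is then [3 c / 4] times the
    contraction of the tangential part of [J tau] with the pull-back [w] of the
    fundamental form ([curvature_contraction]). So it vanishes when [c = 0], and
    when [w = 0], which means that the submanifold is totally real.

    Conversely let the contraction vanish on a surface, with [c] nonzero. Where
    [w] is nonzero, it is nondegenerate since the dimension is 2, so the
    tangential part of [J tau] vanishes there. Differentiating this relation and
    antisymmetrizing gives [w] times the squared length of [tau] equal to 0
    ([kahler_form01_eq0]), which is absurd as [tau] never vanishes. *)

(** * Functions of class C^k on an open set *)
Lemma near_eq_differentiable (R : numFieldType) (V W : normedModType R)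
    (f g : V -> W) (x : V) :
  {near x, f =1 g} -> differentiable f x -> differentiable g x.
Proof.
move=> fg /diffP[cdf /funext/eqaddoP dfE].
have gfx : f x = g x := nbhs_singleton fg.
pose P := fun (df : {linear V -> W}) => continuous df /\ forall y,
      g y = g (lim (nbhs x)) + df (y - lim (nbhs x)) +o_(y \near x) (y - lim (nbhs x)).
suff H : P ('d f x) by apply/diffP => /=; apply: (@getPex _ P); exists ('d f x).
split => //; apply/(@funeqP _ _ g); apply/eqaddoP => e e0.
have := dfE e e0; rewrite lim_id//; apply: filterS2 fg => y fgy.
by rewrite /= -gfx !fctE fgy.
Qed.

Lemma near_open (T : topologicalType) (U : set T) (P : T -> Prop) x :
  open U -> U x -> (forall y, U y -> P y) -> \forall y \near x, P y.
Proof. by move=> oU Ux UP; apply: filterS (open_nbhs_nbhs (conj oU Ux)). Qed.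

Section CkGen.
Context {R : realType} {m : nat}.
Implicit Types (V W : normedModType R) (U : set 'rV[R]_m).

(** The derivatives of sums, products and composites are given by formulas
    valid on [U] only; this lemma turns each of them into an induction step. *)
Lemma eq_Ck k V U (f g : 'rV[R]_m -> V) : open U ->
  (forall x, U x -> f x = g x) -> Ck k U f -> Ck k U g.
Proof.
move=> oU; elim: k f g => [|k IH] f g fg /=.
  move=> fc x Ux; have fx := fg _ Ux.
  have nfg : \forall y \near x, f y = g y by apply: near_open Ux fg.
  rewrite /prop_for /continuous_at -fx; apply: cvg_trans (fc _ Ux).
  exact: near_eq_cvg nfg.
have nfg x : U x -> {near x, f =1 g}.
  by move=> Ux; apply: (near_open oU Ux) => y Uy; exact: fg.
move=> [df Df]; split=> [x Ux|a].
  by apply: near_eq_differentiable (df _ Ux); exact: nfg.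
apply: IH (Df a) => x Ux; apply: near_eq_derive; exact: nfg.
Qed.

Lemma CkS k V U (f : 'rV[R]_m -> V) : Ck k.+1 U f -> Ck k U f.
Proof.
elim: k f => [|k IH] f [df Df]; last by split => // a; exact/IH/Df.
by move=> x Ux; apply: differentiable_continuous; exact: df.
Qed.

Lemma Ck_cst k V U (c : V) : Ck k U (cst c : 'rV[R]_m -> V).
Proof.
elim: k c => [|k IH] c /=; first by move=> x _; exact: cst_continuous.
split=> [x _|a]; first exact: differentiable_cst.
rewrite (_ : (fun _ => _) = cst 0); first exact: IH.
by apply/funext => x; rewrite derive_cst.
Qed.

Lemma Ck_add k V U (f g : 'rV[R]_m -> V) : open U ->
  Ck k U f -> Ck k U g -> Ck k U (fun x => f x + g x).
Proof.
move=> oU; elim: k f g => [|k IH] f g /=.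
  by move=> fc gc x Ux; apply: continuousD; [exact: fc|exact: gc].
move=> [df Df] [dg Dg]; split=> [x Ux|a].
  by apply: differentiableD; [exact: df|exact: dg].
apply: eq_Ck (IH _ _ (Df a) (Dg a)) => // x Ux.
by rewrite deriveD //; apply: diff_derivable; [exact: df|exact: dg].
Qed.

Lemma Ck_linear k V W U (L : {linear V -> W}) (f : 'rV[R]_m -> V) :
  open U -> continuous L -> Ck k U f -> Ck k U (L \o f).
Proof.
move=> oU cL; elim: k f => [|k IH] f /=.
  by move=> fc x Ux; apply: continuous_comp; [exact: fc|exact: cL].
move=> [df Df].
have dL y : differentiable L y by exact: linear_differentiable.
split=> [x Ux|a]; first by apply: differentiable_comp => //; exact: df.
apply: eq_Ck (IH _ (Df a)) => // x Ux.
have dfx := df _ Ux.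
rewrite (deriveE _ (differentiable_comp dfx _))// diff_comp//= deriveE//.
by rewrite diff_lin.
Qed.

(** Leibniz: the derivative at order [k.+1] is a sum of products of functions
    that are of class C^k. *)
Lemma Ck_mul k U (f g : 'rV[R]_m -> R) : open U ->
  Ck k U f -> Ck k U g -> Ck k U (fun x => f x * g x).
Proof.
move=> oU; elim: k f g => [|k IH] f g /=.
  by move=> fc gc x Ux; apply: continuousM; [exact: fc|exact: gc].
move=> Hf Hg; have [df Df] := Hf; have [dg Dg] := Hg.
split=> [x Ux|a]; first by apply: differentiableM; [exact: df|exact: dg].
have := Ck_add oU (IH _ _ (CkS Hf) (Dg a)) (IH _ _ (CkS Hg) (Df a)).
apply: eq_Ck => // x Ux.
by rewrite deriveM //; apply: diff_derivable; [exact: df|exact: dg].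
Qed.

Lemma Ck_inv k U (f : 'rV[R]_m -> R) : open U -> (forall x, U x -> f x != 0) ->
  Ck k U f -> Ck k U (fun x => (f x)^-1).
Proof.
move=> oU f0; elim: k => [|k IH] /=.
  by move=> fc x Ux; apply: continuousV; [exact: f0|exact: fc].
move=> Hf; have [df Df] := Hf.
split=> [x Ux|a]; first by apply: differentiableV; [exact: df|exact: f0].
have If := IH (CkS Hf).
have := Ck_mul oU (Ck_mul oU If If) (Ck_mul oU (Ck_cst k U (-1 : R)) (Df a)).
apply: eq_Ck => // x Ux.
rewrite deriveV; first last.
- by apply: diff_derivable; exact: df.
- exact: f0.
by rewrite /cst -exprVn expr2 mulN1r mulrN -mulNr.
Qed.


Lemma Ck_sum k V U (I : Type) (r : seq I) (P : pred I) (F : I -> 'rV[R]_m -> V) :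
  open U -> (forall i, P i -> Ck k U (F i)) ->
  Ck k U (fun x => \sum_(i <- r | P i) F i x).
Proof.
move=> oU CF; elim: r => [|i r IH].
  by apply: (eq_Ck oU _ (Ck_cst k U 0)) => x _; rewrite big_nil.
have [Pi|nPi] := boolP (P i).
  apply: (eq_Ck oU _ (Ck_add oU (CF _ Pi) IH)) => x _.
  by rewrite big_cons Pi.
by apply: (eq_Ck oU _ IH) => x _; rewrite big_cons (negbTE nPi).
Qed.

Lemma Ck_prod k U (I : Type) (r : seq I) (P : pred I) (F : I -> 'rV[R]_m -> R) :
  open U -> (forall i, P i -> Ck k U (F i)) ->
  Ck k U (fun x => \prod_(i <- r | P i) F i x).
Proof.
move=> oU CF; elim: r => [|i r IH].
  by apply: (eq_Ck oU _ (Ck_cst k U (1 : R))) => x _; rewrite big_nil.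
have [Pi|nPi] := boolP (P i).
  apply: (eq_Ck oU _ (Ck_mul oU (CF _ Pi) IH)) => x _.
  by rewrite big_cons Pi.
by apply: (eq_Ck oU _ IH) => x _; rewrite big_cons (negbTE nPi).
Qed.

Lemma Ck_coord k p q U (F : 'rV[R]_m -> 'M[R]_(p, q)) i j : open U ->
  Ck k U F -> Ck k U (fun x => F x i j).
Proof.
move=> oU; have @L : {linear 'M[R]_(p, q) -> R}.
  by exists (fun N : 'M[R]_(_, _) => N i j); do 2![eexists]; do ?[constructor];
     rewrite ?mxE// => ? *; rewrite ?mxE//; move=> ?; rewrite !mxE.
apply: (@Ck_linear k _ _ U L F oU); exact: coord_continuous.
Qed.

(** A matrix is the sum of its entries times the constant matrices [delta_mx],
    so regularity can be tested on the entries. *)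
Lemma Ck_mx k p q U (F : 'rV[R]_m -> 'M[R]_(p, q)) : open U ->
  (forall i j, Ck k U (fun x => F x i j)) -> Ck k U F.
Proof.
move=> oU CF.
have CL i j : Ck k U (fun x => F x i j *: delta_mx i j : 'M[R]_(p, q)).
  pose L := ( *:%R ^~ (delta_mx i j : 'M[R]_(p, q))) : R -> _.
  have L_lin : linear L by move=> a u v; rewrite /L scalerDl scalerA.
  pose LL := GRing.isLinear.Build _ _ _ _ _ L_lin.
  pose LLL : {linear R -> 'M[R]_(p, q)} := HB.pack L LL.
  apply: (@Ck_linear k _ _ U LLL _ oU _ (CF i j)).
  exact: scalel_continuous.
apply: (eq_Ck oU _ (Ck_sum (P := xpredT) (index_enum _) oU (fun i _ =>
  Ck_sum (P := xpredT) (index_enum _) oU (fun j _ => CL i j)))) => x _.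
by rewrite [RHS]matrix_sum_delta.
Qed.

Lemma derive_coord p q (F : 'rV[R]_m -> 'M[R]_(p, q)) v x i j :
  differentiable F x -> 'D_v F x i j = 'D_v (fun y => F y i j) x.
Proof. by move=> dF; rewrite derive_mx ?mxE //; apply: diff_derivable. Qed.

Lemma derive_sum_basis V (f : 'rV[R]_m -> V) v x : differentiable f x ->
  'D_v f x = \sum_(a < m) v 0 a *: 'D_('e_a) f x.
Proof.
move=> df; rewrite deriveE// {1}(row_sum_delta v) linear_sum /=.
by apply: eq_bigr => a _; rewrite linearZ deriveE.
Qed.

End CkGen.

Lemma derive_comp_dir (R : realType) (V0 V1 V2 : normedModType R)
    (f : V0 -> V1) (u : V1 -> V2) v x :
  differentiable f x -> differentiable u (f x) ->
  'D_v (u \o f) x = 'D_('D_v f x) u (f x).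
Proof.
move=> df du; have dc := differentiable_comp df du.
by rewrite !deriveE// diff_comp.
Qed.

(** By the chain rule each partial derivative of [u \o f] is a sum of products
    of a component of a derivative of [f] and of a partial derivative of [u]
    composed with [f]. *)
Lemma Ck_comp (R : realType) m d k (U : set 'rV[R]_m) (V : set 'rV[R]_d)
    (f : 'rV[R]_m -> 'rV[R]_d) (u : 'rV[R]_d -> R) :
  open U -> open V -> (forall x, U x -> V (f x)) ->
  Ck k U f -> Ck k V u -> Ck k U (u \o f).
Proof.
move=> oU oV UV; elim: k u => [|k IH] u.
  by move=> fc uc x Ux; apply: continuous_comp; [exact: fc|apply: uc; exact: UV].
move=> Hf Hu; have [df Df] := Hf; have [du Du] := Hu.
split=> [x Ux|a].
  by apply: differentiable_comp; [exact: df|apply: du; exact: UV].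
have C1 i := Ck_coord 0 i oU (Df a).
have C2 i := IH _ (CkS Hf) (Du i).
apply: (eq_Ck oU _ (Ck_sum (P := xpredT) (index_enum _) oU (fun i _ =>
  Ck_mul oU (C1 i) (C2 i)))) => x Ux.
have duf := du _ (UV _ Ux).
rewrite (derive_comp_dir _ (df _ Ux) duf).
by rewrite [RHS]derive_sum_basis.
Qed.

(** * Symmetry of second derivatives *)
Section Schwarz.
Context {R : realType} {m : nat}.
Implicit Types (U : set 'rV[R]_m) (u : 'rV[R]_m -> R).

Lemma Ck_derive k (V : normedModType R) U (f : 'rV[R]_m -> V) v : open U ->
  Ck k.+1 U f -> Ck k U ('D_v f).
Proof.
move=> oU [df Df].
have CL a : Ck k U (fun x => v 0 a *: 'D_('e_a) f x : V).
  pose L := ( *:%R (v 0 a)) : V -> V.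
  apply: (@Ck_linear _ _ k _ _ U L _ oU _ (Df a)).
  exact: scaler_continuous.
apply: (eq_Ck oU _ (Ck_sum (P := xpredT) (index_enum _) oU (fun i _ => CL i))).
by move=> x Ux; rewrite derive_sum_basis //; exact: df.
Qed.

Lemma MVT_line u (y v : 'rV[R]_m) (t : R) : 0 < t ->
  (forall s : R, 0 <= s <= t -> differentiable u (y + s *: v)) ->
  exists2 s, 0 < s < t & u (y + t *: v) - u y = t * 'D_v u (y + s *: v).
Proof.
move=> t0 du.
pose l (s : R) := y + s *: v.
have dl s : differentiable l s by apply: differentiableD.
have Dl s : 'D_1 l s = v.
  have -> : l = cst y + ( *:%R ^~ v) by [].
  rewrite deriveD//; last exact: diff_derivable.
  rewrite derive_cst add0r.
  by rewrite deriveE // diff_val scale1r.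
have dul s : 0 <= s <= t -> differentiable (u \o l) s.
  by move=> /du dus; exact: differentiable_comp.
have [||s s0t] := @MVT R (u \o l) (fun s => 'D_v u (l s)) 0 t t0.
- move=> s /[!in_itv]/= /andP[s0 st].
  have sI : 0 <= s <= t by rewrite !ltW.
  apply: DeriveDef; first exact/diff_derivable/dul.
  by rewrite derive_comp_dir ?Dl//; exact: du.
- apply: continuous_in_subspaceT => s /[!inE]/= sI.
  exact/differentiable_continuous/dul.
rewrite /l /= scale0r addr0 subr0 => E; exists s; first by rewrite in_itv in s0t.
by rewrite E mulrC.
Qed.

(** The mean value theorem along [v], applied to the difference of [u] and of
    its translate by [t *: w], and then along [w], applied to the derivative
    of [u] along [v]. *)
Lemma second_difference u (x v w : 'rV[R]_m) (t : R) : 0 < t ->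
  (forall a b : R, 0 <= a <= t -> 0 <= b <= t ->
     differentiable u (x + a *: v + b *: w) /\
     differentiable ('D_v u) (x + a *: v + b *: w)) ->
  exists a b : R, [/\ 0 < a < t, 0 < b < t &
   u (x + t *: v + t *: w) - u (x + t *: v) - u (x + t *: w) + u x =
   t * (t * 'D_w ('D_v u) (x + a *: v + b *: w))].
Proof.
move=> t0 du; have t0t : 0 <= t <= t by rewrite lexx ltW.
have z0t : 0 <= (0 : R) <= t by rewrite lexx ltW.
pose g (y : 'rV[R]_m) := u (y + t *: w) - u y.
have dg1 (y : 'rV[R]_m) : differentiable u (y + t *: w) ->
    differentiable (fun y => u (y + t *: w)) y.
  by move=> d1; apply: (@differentiable_comp _ _ _ _ (fun y => y + t *: w)).
have dg (y : 'rV[R]_m) : differentiable u y -> differentiable u (y + t *: w) ->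
    differentiable g y.
  by move=> d0 d1; apply: differentiableB => //; exact: dg1.
have Dg (y : 'rV[R]_m) : differentiable u y -> differentiable u (y + t *: w) ->
    'D_v g y = 'D_v u (y + t *: w) - 'D_v u y.
  move=> d0 d1; rewrite deriveB; first last.
  - exact: diff_derivable.
  - by apply: diff_derivable; exact: dg1.
  congr (_ - _).
  have da : differentiable (fun y => y + t *: w) y by exact: differentiableD.
  rewrite [LHS](derive_comp_dir _ da d1).
  have -> : (fun y => y + t *: w) = id + cst (t *: w) by [].
  by rewrite deriveD// derive_id derive_cst addr0.
have d0 a : 0 <= a <= t -> differentiable u (x + a *: v).
  by move=> /(du a 0) /(_ z0t)[+ _]; rewrite scale0r addr0.
have [a a0t E1] := @MVT_line g x v t t0 (fun s st => dg _ (d0 s st) (du s t st t0t).1).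
have aI : 0 <= a <= t by case/andP: a0t => ? ?; rewrite !ltW.
rewrite Dg in E1; [|exact: d0|exact: (du _ _ aI t0t).1].
have [b b0t E2] := @MVT_line ('D_v u) (x + a *: v) w t t0 (fun s st => (du a s aI st).2).
exists a, b; split => //.
rewrite -E2 -E1 /g opprB addrA addrAC; congr (_ + _); rewrite -!addrA; congr (_ + _).
Qed.

(** Schwarz: the second difference is symmetric in [v] and [w], so both mixed
    derivatives take a common value at points arbitrarily close to [x], and
    they are continuous at [x]. *)
Lemma derive_swap U u (x v w : 'rV[R]_m) : open U -> Ck 2 U u -> U x ->
  'D_v ('D_w u) x = 'D_w ('D_v u) x.
Proof.
move=> oU Cu Ux.
have C1 z := Ck_derive z oU Cu.
have cA : {for x, continuous ('D_v ('D_w u))} by apply: (Ck_derive v oU (C1 w)).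
have cB : {for x, continuous ('D_w ('D_v u))} by apply: (Ck_derive w oU (C1 v)).
apply/eqP/negPn/negP => AB.
pose e := `|'D_v ('D_w u) x - 'D_w ('D_v u) x| / 2.
have e0 : 0 < e by rewrite divr_gt0 // normr_gt0 subr_eq0.
have nU : \forall y \near x, U y by exact: open_nbhs_nbhs.
have nA : \forall y \near x, `|'D_v ('D_w u) x - 'D_v ('D_w u) y| < e.
  by move/cvgrPdist_lt : cA => /(_ _ e0).
have nB : \forall y \near x, `|'D_w ('D_v u) x - 'D_w ('D_v u) y| < e.
  by move/cvgrPdist_lt : cB => /(_ _ e0).
have [r /= r0 Hr] := (nbhs_ballP _ _).1 (filterI nU (filterI nA nB)).
(* With this width every intermediate point of the second difference lies within
   distance [r] of [x], where both continuity estimates hold. *)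
pose t := r / (`|v| + `|w| + 1).
have k0 : 0 < `|v| + `|w| + 1 by rewrite ltr_wpDl // addr_ge0.
have t0 : 0 < t by rewrite divr_gt0.
have inb a b v' w' : 0 <= a <= t -> 0 <= b <= t -> `|v'| + `|w'| = `|v| + `|w| ->
    ball x r (x + a *: v' + b *: w').
  move=> /andP[a0 at_] /andP[b0 bt] vw.
  rewrite -ball_normE /ball_ /= -addrA opprD addNKr normrN.
  apply: le_lt_trans (ler_normD _ _) _; rewrite !normrZ !ger0_norm//.
  apply: (@le_lt_trans _ _ (t * (`|v| + `|w|))).
    by rewrite -vw mulrDr lerD// ler_wpM2r.
  have -> : r = t * (`|v| + `|w| + 1) by rewrite /t divfK// gt_eqF.
  by rewrite ltr_pM2l // ltrDl.
have step v' w' : `|v'| + `|w'| = `|v| + `|w| -> exists a b,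
    ball x r (x + a *: v' + b *: w') /\
    u (x + t *: v' + t *: w') - u (x + t *: v') - u (x + t *: w') + u x =
    t * (t * 'D_w' ('D_v' u) (x + a *: v' + b *: w')).
  move=> vw; have [|a [b [/andP[a0 at_] /andP[b0 bt] E]]] :=
    @second_difference u x v' w' t t0.
    move=> a b aI bI; have [Uy _] := Hr _ (inb _ _ _ _ aI bI vw).
    by split; [exact: Cu.1|exact: (C1 v').1].
  by exists a, b; split => //; apply: inb => //; rewrite !ltW.
have [a [b [/Hr[_ [_ +]] +]]] := step v w erefl.
have [a' [b' [/Hr[_ [+ _]] +]]] := step w v (addrC _ _).
move: ('D_v ('D_w u) _) ('D_w ('D_v u) (_ + _)) => A B A1 E2 B1 E1.
have E : t * (t * B) = t * (t * A).
  rewrite -E1 -E2 [x + t *: w + _]addrAC; congr (_ + _).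
  by rewrite -!addrA; congr (_ + _); rewrite addrC.
have {E1 E2}AB' : B = A.
  have tn0 : t != 0 by rewrite gt_eqF.
  have := mulfI tn0 E; exact: mulfI.
have : `|'D_v ('D_w u) x - 'D_w ('D_v u) x| < e + e.
  apply: le_lt_trans (ler_distD B _ _) _; rewrite distrC in B1.
  by apply: ltrD => //; rewrite AB'.
by rewrite /e -splitr ltxx.
Qed.

End Schwarz.

(** * Calculus of smooth functions with values in matrices *)
Section Smooth.
Context {R : realType} {m : nat} {U : set 'rV[R]_m} (oU : open U).
Implicit Types (c : 'rV[R]_m -> R).

Lemma smooth_differentiable (V : normedModType R) (f : 'rV[R]_m -> V) x :
  smooth_on U f -> U x -> differentiable f x.
Proof. by move=> /(_ 1%N)[df _]; exact: df. Qed.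

Lemma smooth_derivable (V : normedModType R) (f : 'rV[R]_m -> V) x v :
  smooth_on U f -> U x -> derivable f x v.
Proof. by move=> sf Ux; apply: diff_derivable; exact: smooth_differentiable Ux. Qed.

Lemma eq_smooth (V : normedModType R) (f g : 'rV[R]_m -> V) :
  (forall x, U x -> f x = g x) -> smooth_on U f -> smooth_on U g.
Proof. by move=> fg sf k; exact: eq_Ck (sf k). Qed.

Lemma eq_derive (V : normedModType R) (f g : 'rV[R]_m -> V) v x :
  (forall x, U x -> f x = g x) -> U x -> 'D_v f x = 'D_v g x.
Proof. by move=> fg Ux; apply: near_eq_derive; exact: near_open Ux fg. Qed.

Lemma smooth_cst (V : normedModType R) (a : V) :
  smooth_on U (fun _ : 'rV[R]_m => a).
Proof. by move=> k; exact: Ck_cst. Qed.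

Lemma smooth_add (V : normedModType R) (f g : 'rV[R]_m -> V) :
  smooth_on U f -> smooth_on U g -> smooth_on U (fun x => f x + g x).
Proof. by move=> sf sg k; exact: Ck_add. Qed.

Lemma smooth_mul (f g : 'rV[R]_m -> R) :
  smooth_on U f -> smooth_on U g -> smooth_on U (fun x => f x * g x).
Proof. by move=> sf sg k; exact: Ck_mul. Qed.

Lemma smooth_sum (V : normedModType R) (I : Type) (r : seq I) (P : pred I)
    (F : I -> 'rV[R]_m -> V) :
  (forall i, P i -> smooth_on U (F i)) ->
  smooth_on U (fun x => \sum_(i <- r | P i) F i x).
Proof. by move=> sF k; apply: Ck_sum => // i Pi; exact: sF. Qed.

Lemma smooth_prod (I : Type) (r : seq I) (P : pred I) (F : I -> 'rV[R]_m -> R) :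
  (forall i, P i -> smooth_on U (F i)) ->
  smooth_on U (fun x => \prod_(i <- r | P i) F i x).
Proof. by move=> sF k; apply: Ck_prod => // i Pi; exact: sF. Qed.

Lemma smooth_derive (V : normedModType R) (f : 'rV[R]_m -> V) v :
  smooth_on U f -> smooth_on U ('D_v f).
Proof. by move=> sf k; exact: Ck_derive (sf k.+1). Qed.

Lemma smooth_coord p q (F : 'rV[R]_m -> 'M[R]_(p, q)) i j :
  smooth_on U F -> smooth_on U (fun x => F x i j).
Proof. by move=> sF k; exact: Ck_coord. Qed.

Lemma smooth_mx p q (F : 'rV[R]_m -> 'M[R]_(p, q)) :
  (forall i j, smooth_on U (fun x => F x i j)) -> smooth_on U F.
Proof. by move=> sF k; apply: Ck_mx => // i j; exact: sF. Qed.

Lemma smooth_scale p q c (F : 'rV[R]_m -> 'M[R]_(p, q)) :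
  smooth_on U c -> smooth_on U F -> smooth_on U (fun x => c x *: F x).
Proof.
move=> sc sF; apply: smooth_mx => i j.
apply: (eq_smooth (f := fun x => c x * F x i j)) => [x _|]; first by rewrite mxE.
exact: smooth_mul (smooth_coord i j sF).
Qed.

Lemma smooth_opp p q (F : 'rV[R]_m -> 'M[R]_(p, q)) :
  smooth_on U F -> smooth_on U (fun x => - F x).
Proof.
move=> sF; have := smooth_scale (smooth_cst (- 1 : R)) sF.
by apply: eq_smooth => x _; rewrite scaleN1r.
Qed.

Lemma smooth_mulmx p q r (A : 'rV[R]_m -> 'M[R]_(p, q))
    (B : 'rV[R]_m -> 'M[R]_(q, r)) :
  smooth_on U A -> smooth_on U B -> smooth_on U (fun x => A x *m B x).
Proof.
move=> sA sB; apply: smooth_mx => i j.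
apply: (eq_smooth (f := fun x => \sum_k A x i k * B x k j)) => [x _|].
  by rewrite mxE.
apply: smooth_sum => k _.
exact: smooth_mul (smooth_coord i k sA) (smooth_coord k j sB).
Qed.

Lemma smooth_tr p q (A : 'rV[R]_m -> 'M[R]_(p, q)) :
  smooth_on U A -> smooth_on U (fun x => (A x)^T).
Proof.
move=> sA; apply: smooth_mx => i j.
by apply: eq_smooth (smooth_coord j i sA) => x _; rewrite mxE.
Qed.

Lemma smooth_det p (A : 'rV[R]_m -> 'M[R]_p) :
  smooth_on U A -> smooth_on U (fun x => \det (A x)).
Proof.
move=> sA; apply: smooth_sum => s _; apply: smooth_mul; first exact: smooth_cst.
by apply: smooth_prod => i _; exact: smooth_coord.
Qed.

(** Cramer: the inverse is the adjugate, whose entries are polynomials in those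
    of [A], divided by the determinant. *)
Lemma smooth_invmx p (A : 'rV[R]_m -> 'M[R]_p) :
  smooth_on U A -> (forall x, U x -> A x \in unitmx) ->
  smooth_on U (fun x => invmx (A x)).
Proof.
move=> sA uA; have sd := smooth_det sA.
have d0 x : U x -> \det (A x) != 0 by move=> /uA; rewrite unitmxE unitfE.
have si : smooth_on U (fun x => (\det (A x))^-1).
  by move=> k; exact: Ck_inv (sd k).
apply: (eq_smooth (f := fun x => (\det (A x))^-1 *: \adj (A x))) => [x Ux|].
  by rewrite /invmx uA.
apply: smooth_scale => //; apply: smooth_mx => i j.
apply: (eq_smooth (f := fun x => cofactor (A x) j i)) => [x _|].
  by rewrite mxE.
apply: smooth_mul; first exact: smooth_cst.
apply: smooth_det; apply: smooth_mx => k l.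
by apply: eq_smooth (smooth_coord (lift j k) (lift i l) sA) => x _; rewrite !mxE.
Qed.

Lemma derive_coord_smooth p q (F : 'rV[R]_m -> 'M[R]_(p, q)) v x i j :
  smooth_on U F -> U x -> 'D_v F x i j = 'D_v (fun y => F y i j) x.
Proof. by move=> sF Ux; apply: derive_coord; exact: smooth_differentiable Ux. Qed.

Lemma derive_mul (f g : 'rV[R]_m -> R) v x :
  smooth_on U f -> smooth_on U g -> U x ->
  'D_v (fun y => f y * g y) x = 'D_v f x * g x + f x * 'D_v g x.
Proof.
move=> sf sg Ux.
rewrite (deriveM (smooth_derivable sf Ux) (smooth_derivable sg Ux)).
by rewrite addrC; congr (_ + _); exact: mulrC.
Qed.

Lemma derive_add (V : normedModType R) (f g : 'rV[R]_m -> V) v x :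
  smooth_on U f -> smooth_on U g -> U x ->
  'D_v (fun y => f y + g y) x = 'D_v f x + 'D_v g x.
Proof.
move=> sf sg Ux.
by rewrite (deriveD (smooth_derivable sf Ux) (smooth_derivable sg Ux)).
Qed.

Lemma derive_bigsum n (F : 'I_n -> 'rV[R]_m -> R) v x :
  (forall i, smooth_on U (F i)) -> U x ->
  'D_v (fun y => \sum_i F i y) x = \sum_i 'D_v (F i) x.
Proof.
move=> sF Ux; rewrite -derive_sum => [|i]; last exact: smooth_derivable Ux.
by congr ('D_v _ x); apply/funext => y; rewrite fct_sumE.
Qed.

Lemma derive_mulmx p q r (A : 'rV[R]_m -> 'M[R]_(p, q))
    (B : 'rV[R]_m -> 'M[R]_(q, r)) v x :
  smooth_on U A -> smooth_on U B -> U x ->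
  'D_v (fun y => A y *m B y) x = 'D_v A x *m B x + A x *m 'D_v B x.
Proof.
move=> sA sB Ux; apply/matrixP => i j.
rewrite derive_coord_smooth//; last exact: smooth_mulmx.
transitivity ('D_v (fun y => \sum_k A y i k * B y k j) x).
  by congr ('D_v _ x); apply/funext => y; rewrite mxE.
have sAB k : smooth_on U (fun y => A y i k * B y k j).
  exact: smooth_mul (smooth_coord i k sA) (smooth_coord k j sB).
rewrite derive_bigsum// !mxE -big_split; apply: eq_bigr => k _ /=.
rewrite derive_mul //; [|exact: smooth_coord|exact: smooth_coord].
by rewrite !derive_coord_smooth.
Qed.

Lemma derive_tr p q (A : 'rV[R]_m -> 'M[R]_(p, q)) v x :
  smooth_on U A -> U x -> 'D_v (fun y => (A y)^T) x = ('D_v A x)^T.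
Proof.
move=> sA Ux; apply/matrixP => i j; rewrite mxE !derive_coord_smooth//.
  by congr ('D_v _ x); apply/funext => y; rewrite mxE.
exact: smooth_tr.
Qed.

Lemma derive_scale p q c (F : 'rV[R]_m -> 'M[R]_(p, q)) v x :
  smooth_on U c -> smooth_on U F -> U x ->
  'D_v (fun y => c y *: F y) x = 'D_v c x *: F x + c x *: 'D_v F x.
Proof.
move=> sc sF Ux; apply/matrixP => i j.
rewrite derive_coord_smooth//; last exact: smooth_scale.
transitivity ('D_v (fun y => c y * F y i j) x).
  by congr ('D_v _ x); apply/funext => y; rewrite mxE.
rewrite derive_mul //; last exact: smooth_coord.
by rewrite !mxE derive_coord_smooth.
Qed.

Lemma derive2_coord p q (F : 'rV[R]_m -> 'M[R]_(p, q)) v w x i j :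
  smooth_on U F -> U x -> 'D_v ('D_w F) x i j = 'D_v ('D_w (fun z => F z i j)) x.
Proof.
move=> sF Ux; rewrite (derive_coord_smooth _ _ _ (smooth_derive w sF) Ux).
by apply: eq_derive => // y Uy; exact: derive_coord_smooth.
Qed.

Lemma derive_swap_mx p q (F : 'rV[R]_m -> 'M[R]_(p, q)) v w x :
  smooth_on U F -> U x -> 'D_v ('D_w F) x = 'D_w ('D_v F) x.
Proof.
move=> sF Ux; apply/matrixP => i j.
apply: etrans (derive2_coord v w i j sF Ux) _.
apply: etrans _ (esym (derive2_coord w v i j sF Ux)).
exact: derive_swap oU (smooth_coord i j sF 2) Ux.
Qed.

End Smooth.

Section SmoothComp.
Context {R : realType} {m d : nat} {U : set 'rV[R]_m} {V : set 'rV[R]_d}.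
Context (oU : open U) (oV : open V) (f : 'rV[R]_m -> 'rV[R]_d).
Context (UV : forall x, U x -> V (f x)) (sf : smooth_on U f).

Lemma smooth_comp (u : 'rV[R]_d -> R) :
  smooth_on V u -> smooth_on U (fun x => u (f x)).
Proof. by move=> su k; exact: Ck_comp (su k). Qed.

Lemma smooth_comp_mx p q (u : 'rV[R]_d -> 'M[R]_(p, q)) :
  smooth_on V u -> smooth_on U (fun x => u (f x)).
Proof.
move=> su; apply: (smooth_mx oU) => i j.
exact: (smooth_comp (smooth_coord oV i j su)).
Qed.

Lemma derive_compE (W : normedModType R) (u : 'rV[R]_d -> W) v x :
  smooth_on V u -> U x -> 'D_v (fun y => u (f y)) x = 'D_('D_v f x) u (f x).
Proof.
move=> su Ux; apply: derive_comp_dir; first exact: smooth_differentiable Ux.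
exact: smooth_differentiable (UV Ux).
Qed.

End SmoothComp.

(** * Curvature-like tensors with constant holomorphic sectional curvature *)
Section Polarization.
Context {R : realFieldType} {V : zmodType} (J : V -> V).
Hypothesis JD : forall X Y, J (X + Y) = J X + J Y.
Hypothesis JJ : forall X, J (J X) = - X.
Variable T : V -> V -> V -> V -> R.
Hypothesis TD : forall X Y Z W W', T X Y Z (W + W') = T X Y Z W + T X Y Z W'.
Hypothesis T12 : forall X Y Z W, T X Y Z W = - T Y X Z W.
Hypothesis T34 : forall X Y Z W, T X Y Z W = - T X Y W Z.
Hypothesis Tbianchi : forall X Y Z W, T X Y Z W + T Y Z X W + T Z X Y W = 0.

(** Put each vector in the last slot in turn: the sum of two of the four Bianchi
    identities minus the sum of the other two. *)
Lemma curvature_pair_sym X Y Z W : T X Y Z W = T Z W X Y.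
Proof.
have := Tbianchi X Y Z W; have := Tbianchi Y Z W X.
have := Tbianchi Z W X Y; have := Tbianchi W X Y Z.
rewrite (T12 Z X Y W) (T34 Y Z W X) (T34 Z W Y X) (T12 W Y Z X) (T34 Y W Z X).
rewrite (T12 W X Z Y) (T34 X W Z Y) (T34 X Z W Y) (T12 W X Y Z) (T34 X Y W Z).
lra.
Qed.

Hypothesis TJ : forall X Y Z W, T X Y (J Z) (J W) = T X Y Z W.
Hypothesis T0 : forall X, T X (J X) (J X) X = 0.

Let Tsym := curvature_pair_sym.

Let TD3 X Y Z Z' W : T X Y (Z + Z') W = T X Y Z W + T X Y Z' W.
Proof. by rewrite T34 TD opprD -(T34 X Y Z) -(T34 X Y Z'). Qed.
Let TD1 X X' Y Z W : T (X + X') Y Z W = T X Y Z W + T X' Y Z W.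
Proof. by rewrite Tsym TD3 (Tsym Z W X) (Tsym Z W X'). Qed.
Let TD2 X Y Y' Z W : T X (Y + Y') Z W = T X Y Z W + T X Y' Z W.
Proof. by rewrite Tsym TD (Tsym Z W X Y) (Tsym Z W X Y'). Qed.
Let T0l Y Z W : T 0 Y Z W = 0.
Proof. by have := TD1 0 0 Y Z W; rewrite addr0; lra. Qed.
Let TN1 X Y Z W : T (- X) Y Z W = - T X Y Z W.
Proof. by have := TD1 X (- X) Y Z W; rewrite subrr T0l; lra. Qed.
Let TN2 X Y Z W : T X (- Y) Z W = - T X Y Z W.
Proof. by rewrite T12 TN1 -(T12 X Y). Qed.
Let TN3 X Y Z W : T X Y (- Z) W = - T X Y Z W.
Proof. by rewrite Tsym TN1 (Tsym Z W X Y). Qed.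
Let TN4 X Y Z W : T X Y Z (- W) = - T X Y Z W.
Proof. by rewrite T34 TN3 -(T34 X Y Z). Qed.
Let JN X : J (- X) = - J X.
Proof. by rewrite -!JJ. Qed.

(* These two rules make [T X (J Y) Z (J W)] symmetric in [X], [Y] and in
   [Z], [W]. *)
Let TJ34 X Y Z W : T X Y (J Z) W = - T X Y Z (J W).
Proof. by rewrite -TJ JJ TN3. Qed.
Let TJ12 X Y Z W : T (J X) Y Z W = - T X (J Y) Z W.
Proof. by rewrite Tsym TJ34 (Tsym Z W X). Qed.

Let TXX X Y : T X Y X Y = 0.
Proof.
(* The quartic form [T C (J C) C (J C)] vanishes; [H] is the part of degree 2
   in each of [A] and [B] of its value at [C = A + B], isolated by adding
   its value at [C = A - B]. *)
have H A B : T A (J A) B (J B) + 2 * T A (J B) A (J B) = 0.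
  have E C : T C (J C) C (J C) = 0 by rewrite T34 T0 oppr0.
  have swap C D Z W : T D (J C) Z W = T C (J D) Z W by rewrite T12 TJ12 opprK.
  have swap' C D Z W : T Z W D (J C) = T Z W C (J D).
    by rewrite Tsym swap (Tsym C (J D)).
  have := E (A + B); have := E (A - B); have := E A; have := E B.
  rewrite !(JD, JN, TD, TD1, TD2, TD3, TN1, TN2, TN3, TN4).
  rewrite !(swap A B) !(swap' A B) (Tsym B (J B) A (J A)).
  lra.
(* Bianchi rewrites the first term of [H]. Replacing [B] by [J B] exchanges
   the two terms of [H2], which leaves a system with determinant 8. *)
have H2 A B : 3 * T A (J B) A (J B) + T A B A B = 0.
  have := Tbianchi A (J A) B (J B); have := H A B.
  rewrite (T12 (J A) B) (T12 B A) TJ.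
  rewrite (_ : T B (J A) A (J B) = T A (J B) A (J B)); last by rewrite T12 TJ12 opprK.
  lra.
have := H2 X Y; have := H2 X (J Y).
rewrite JJ TN2 TN4; lra.
Qed.

Let TXZ X Y W : T X Y X W = 0.
Proof.
have := TXX X (Y + W); rewrite TD TD2 TD2 !TXX.
rewrite (Tsym X W X Y); lra.
Qed.

(** A Kaehler curvature tensor is determined by its holomorphic sectional
    curvatures. Once [T X Y X W] vanishes, [T] is skew in its first and third
    arguments, so the three terms of the Bianchi identity are all equal. *)
Lemma holomorphic_flat_curvature X Y Z W : T X Y Z W = 0.
Proof.
have T13 A B C D : T A B C D = - T C B A D.
  have := TXZ (A + C) B D; rewrite TD1 !TD3 !TXZ; lra.
have := Tbianchi X Y Z W.
rewrite (T13 Y Z X W) (T12 X Z Y W) (T13 Z X Y W) (T12 Y X Z W).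
lra.
Qed.

End Polarization.

Section SpaceFormAlgebra.
Context {R : realFieldType} {V : zmodType} (J : V -> V).
Hypothesis JD : forall X Y, J (X + Y) = J X + J Y.
Hypothesis JJ : forall X, J (J X) = - X.
Variable T : V -> V -> V -> V -> R.
Hypothesis TD : forall X Y Z W W', T X Y Z (W + W') = T X Y Z W + T X Y Z W'.
Hypothesis T12 : forall X Y Z W, T X Y Z W = - T Y X Z W.
Hypothesis T34 : forall X Y Z W, T X Y Z W = - T X Y W Z.
Hypothesis Tbianchi : forall X Y Z W, T X Y Z W + T Y Z X W + T Z X Y W = 0.
Hypothesis TJ : forall X Y Z W, T X Y (J Z) (J W) = T X Y Z W.
Variables (g : V -> V -> R) (c : R).
Hypothesis gD : forall X Y Y', g X (Y + Y') = g X Y + g X Y'.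
Hypothesis gC : forall X Y, g X Y = g Y X.
Hypothesis gJ : forall X Y, g (J X) (J Y) = g X Y.
Hypothesis Thol : forall X, T X (J X) (J X) X = c * g X X ^+ 2.

Let w X Y := g (J X) Y.
(** The curvature tensor of a complex space form of holomorphic sectional
    curvature [c], written with the Kaehler form [w]. *)
Definition space_form_tensor X Y Z W : R := c / 4 *
  (g Y Z * g X W - g X Z * g Y W + w Y Z * w X W - w X Z * w Y W
   - 2 * w X Y * w Z W).
Let T0 := space_form_tensor.

Let gN X Y : g (- X) Y = - g X Y.
Proof.
have g0 : g Y 0 = 0 by have := gD Y 0 0; rewrite addr0; lra.
by have := gD Y (- X) X; rewrite addNr g0 !(gC Y); lra.
Qed.
Let wJ X Y : w X (J Y) = g X Y. Proof. exact: gJ. Qed.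
Let gJr X Y : g X (J Y) = - w X Y. Proof. by rewrite -gJ JJ gC gN gC. Qed.
Let wC X Y : w X Y = - w Y X. Proof. by rewrite /w gC gJr. Qed.
Let wJJ X Y : w (J X) (J Y) = w X Y.
Proof. by rewrite wJ gC gJr wC opprK. Qed.
Let wXX X : w X X = 0. Proof. by have := wC X X; lra. Qed.

(** The difference of the two sides is a Kaehler curvature tensor whose
    holomorphic sectional curvatures all vanish. *)
Lemma space_form_tensorE X Y Z W : T X Y Z W = space_form_tensor X Y Z W.
Proof.
apply/subr0_eq; move: X Y Z W.
apply: (holomorphic_flat_curvature JD JJ (T := fun X Y Z W => T X Y Z W - T0 X Y Z W)).
- by move=> X Y Z W W'; rewrite TD /T0 /space_form_tensor !gD /w !gD; ring.
- by move=> X Y Z W; rewrite T12 /T0 /space_form_tensor (wC Y X); ring.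
- by move=> X Y Z W; rewrite T34 /T0 /space_form_tensor (wC W Z); ring.
- move=> X Y Z W; have := Tbianchi X Y Z W; rewrite /T0 /space_form_tensor.
  rewrite (gC Z X) (gC Z Y) (gC Y X) (wC Z X) (wC Z Y) (wC Y X).
  move: (T X Y Z W) (T Y Z X W) (T Z X Y W) => t1 t2 t3 E.
  have {E}-> : t1 = - t2 - t3 by lra.
  ring.
- by move=> X Y Z W; rewrite TJ /T0 /space_form_tensor wJJ !wJ !gJr; ring.
- move=> X; rewrite Thol /T0 /space_form_tensor gJ !gJr wJJ !wXX wJ (wC (J X)) wJ.
  by field.
Qed.

End SpaceFormAlgebra.

(** * The Levi-Civita connection of a metric in coordinates *)
Section InnerAlgebra.
Context {R : realType} {d : nat} (h : 'rV[R]_d -> 'M[R]_d) (z : 'rV[R]_d).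
Implicit Types X Y Z W : 'rV[R]_d.

Lemma innerE X Y : inner h z X Y = \sum_i \sum_j X 0 i * Y 0 j * h z i j.
Proof.
rewrite /inner mxE exchange_big; apply: eq_bigr => j _ /=.
rewrite !mxE mulr_suml; apply: eq_bigr => i _.
by rewrite mulrAC.
Qed.

Lemma innerDl X X' Y : inner h z (X + X') Y = inner h z X Y + inner h z X' Y.
Proof. by rewrite /inner !mulmxDl mxE. Qed.
Lemma innerDr X Y Y' : inner h z X (Y + Y') = inner h z X Y + inner h z X Y'.
Proof. by rewrite /inner raddfD /= mulmxDr mxE. Qed.
Lemma innerZl a X Y : inner h z (a *: X) Y = a * inner h z X Y.
Proof. by rewrite /inner -!scalemxAl mxE. Qed.
Lemma innerZr a X Y : inner h z X (a *: Y) = a * inner h z X Y.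
Proof. by rewrite /inner linearZ /= -!scalemxAr mxE. Qed.
Lemma inner0l Y : inner h z 0 Y = 0.
Proof. by rewrite /inner !mul0mx mxE. Qed.
Lemma inner0r X : inner h z X 0 = 0.
Proof. by rewrite /inner trmx0 mulmx0 mxE. Qed.
Lemma innerNl X Y : inner h z (- X) Y = - inner h z X Y.
Proof. by rewrite -scaleN1r innerZl mulN1r. Qed.
Lemma innerNr X Y : inner h z X (- Y) = - inner h z X Y.
Proof. by rewrite -scaleN1r innerZr mulN1r. Qed.
Lemma innerBl X X' Y : inner h z (X - X') Y = inner h z X Y - inner h z X' Y.
Proof. by rewrite innerDl innerNl. Qed.
Lemma innerBr X Y Y' : inner h z X (Y - Y') = inner h z X Y - inner h z X Y'.
Proof. by rewrite innerDr innerNr. Qed.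
Lemma inner_suml n (F : 'I_n -> 'rV[R]_d) Y :
  inner h z (\sum_i F i) Y = \sum_i inner h z (F i) Y.
Proof.
elim/big_rec2: _ => [|i A B _ <-]; [exact: inner0l|by rewrite innerDl].
Qed.
Lemma inner_sumr n (F : 'I_n -> 'rV[R]_d) X :
  inner h z X (\sum_i F i) = \sum_i inner h z X (F i).
Proof.
elim/big_rec2: _ => [|i A B _ <-]; [exact: inner0r|by rewrite innerDr].
Qed.

Lemma gammaDr X Y Y' : gamma h z X (Y + Y') = gamma h z X Y + gamma h z X Y'.
Proof.
apply/rowP => l; rewrite !mxE -big_split; apply: eq_bigr => i _ /=.
rewrite -big_split; apply: eq_bigr => j _ /=.
by rewrite mxE mulrDr.
Qed.
Lemma gammaZl a X Y : gamma h z (a *: X) Y = a *: gamma h z X Y.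
Proof.
apply/rowP => l; rewrite !mxE mulr_sumr; apply: eq_bigr => i _ /=.
rewrite mulr_sumr; apply: eq_bigr => j _ /=.
rewrite mxE; ring.
Qed.
Lemma gammaZr a X Y : gamma h z X (a *: Y) = a *: gamma h z X Y.
Proof.
apply/rowP => l; rewrite !mxE mulr_sumr; apply: eq_bigr => i _ /=.
rewrite mulr_sumr; apply: eq_bigr => j _ /=.
rewrite mxE; ring.
Qed.
Lemma gamma0l Y : gamma h z 0 Y = 0.
Proof. by have := gammaZl 0 0 Y; rewrite !scale0r. Qed.
End InnerAlgebra.

HB.lock Definition dmetric (R : realType) d (h : 'rV[R]_d -> 'M[R]_d)
  (z Z X Y : 'rV[R]_d) : R := inner ('D_Z h) z X Y.

HB.lock Definition dgamma (R : realType) d (h : 'rV[R]_d -> 'M[R]_d)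
  (z Z X Y : 'rV[R]_d) : 'rV[R]_d := 'D_Z (fun y => gamma h y X Y) z.

(** The data of one chart: nothing below compares two charts. *)
Record metric_on (R : realType) d (V : set 'rV[R]_d) (h : 'rV[R]_d -> 'M[R]_d)
    : Prop := MetricOn {
  metric_on_open : open V ;
  metric_on_smooth : smooth_on V h ;
  metric_on_sym : forall z, V z -> (h z)^T = h z ;
  metric_on_pos : forall z, V z ->
    forall X : 'rV[R]_d, X != 0 -> 0 < inner h z X X }.

Record smooth_map (R : realType) m d (U : set 'rV[R]_m) (V : set 'rV[R]_d)
    (f : 'rV[R]_m -> 'rV[R]_d) : Prop := SmoothMap {
  smooth_map_open : open U ;
  smooth_map_smooth : smooth_on U f ;
  smooth_map_sub : forall x, U x -> V (f x) }.

Section LocalMetric.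
Context {R : realType} {d : nat} {V : set 'rV[R]_d} {h : 'rV[R]_d -> 'M[R]_d}.
Hypothesis Hh : metric_on V h.
Let oV := metric_on_open Hh.
Let sh := metric_on_smooth Hh.
Let hsym := metric_on_sym Hh.
Let hpos := metric_on_pos Hh.
Implicit Types X Y Z W : 'rV[R]_d.

Lemma inner_sym z X Y : V z -> inner h z X Y = inner h z Y X.
Proof.
move=> /hsym hz; have := congr1 (fun A : 'M[R]_(1, 1) => A 0 0) (trmx_mul (X *m h z) Y^T).
by rewrite mxE trmxK trmx_mul hz mulmxA.
Qed.

Lemma inner_nondegenerate z X : V z -> (forall Y, inner h z X Y = 0) -> X = 0.
Proof.
move=> Vz X0; apply/eqP/negPn/negP => Xn0.
by have := hpos Vz Xn0; rewrite X0 ltxx.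
Qed.

Lemma inner_inj z X X' : V z -> (forall Y, inner h z X Y = inner h z X' Y) -> X = X'.
Proof.
move=> Vz XX'; apply/subr0_eq; apply: (inner_nondegenerate Vz) => Y.
by rewrite innerBl XX' subrr.
Qed.

Lemma metric_unit z : V z -> h z \in unitmx.
Proof.
move=> Vz; rewrite -row_free_unit; apply: inj_row_free => v vh.
by apply: (inner_nondegenerate Vz) => Y; rewrite /inner vh mul0mx mxE.
Qed.

Lemma smooth_metric_coord i j : smooth_on V (fun y => h y i j).
Proof. exact: smooth_coord. Qed.

Lemma derive_metric z Z X Y : V z ->
  dmetric h z Z X Y =
  \sum_k \sum_i \sum_j Z 0 k * X 0 i * Y 0 j * 'D_('e_k) (fun y => h y i j) z.
Proof.
move=> Vz; rewrite dmetric.unlock innerE.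
transitivity (\sum_i \sum_j \sum_k Z 0 k * X 0 i * Y 0 j * 'D_('e_k) (fun y => h y i j) z).
  apply: eq_bigr => i _; apply: eq_bigr => j _.
  rewrite (derive_coord_smooth _ _ _ sh Vz) derive_sum_basis; last first.
    exact: smooth_differentiable (smooth_metric_coord i j) Vz.
  by rewrite mulr_sumr; apply: eq_bigr => k _; rewrite /GRing.scale /=; ring.
rewrite [RHS]exchange_big; apply: eq_bigr => i _ /=.
by rewrite exchange_big.
Qed.

Lemma derive_metric_sym z Z X Y : V z -> dmetric h z Z X Y = dmetric h z Z Y X.
Proof.
move=> Vz; rewrite !(derive_metric _ _ _ Vz); apply: eq_bigr => k _.
rewrite exchange_big; apply: eq_bigr => i _ /=; apply: eq_bigr => j _ /=.
rewrite (eq_derive oV (f := fun y => h y j i) (g := fun y => h y i j))//; first by ring.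
by move=> y /hsym hy; rewrite -[in LHS]hy mxE.
Qed.

(** Koszul formula for fields with constant components. The right-hand side is
    a covector in [Z], and the Christoffel symbols are its components raised
    by the inverse metric. *)
Lemma koszul z X Y Z : V z ->
  inner h z (gamma h z X Y) Z =
  2^-1 * (dmetric h z X Y Z + dmetric h z Y X Z
          - dmetric h z Z X Y).
Proof.
move=> Vz.
pose S i j k := 'D_('e_i) (fun y => h y j k) z + 'D_('e_j) (fun y => h y i k) z
     - 'D_('e_k) (fun y => h y i j) z.
pose K : 'rV[R]_d := \row_k \sum_i \sum_j 2^-1 * S i j k * X 0 i * Y 0 j.
have -> : gamma h z X Y = K *m invmx (h z).
  apply/rowP => l; rewrite !mxE.
  transitivity (\sum_i \sum_j \sum_k invmx (h z) k l * (2^-1 * S i j k * X 0 i * Y 0 j)).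
    apply: eq_bigr => i _; apply: eq_bigr => j _.
    rewrite /christoffel mulr_sumr !mulr_suml; apply: eq_bigr => k _.
    have -> : invmx (h z) l k = invmx (h z) k l.
      by rewrite -[in RHS](hsym Vz) -trmx_inv mxE.
    by rewrite -/(S i j k); ring.
  under eq_bigr do rewrite exchange_big /=.
  rewrite exchange_big; apply: eq_bigr => k _ /=.
  rewrite mxE mulr_suml; apply: eq_bigr => i _; rewrite mulr_suml.
  by apply: eq_bigr => j _; rewrite mulrC.
rewrite [LHS]/inner mulmxKV ?metric_unit// mxE.
transitivity (\sum_i \sum_j \sum_k 2^-1 * (S i j k * X 0 i * Y 0 j * Z 0 k)).
  under eq_bigr do rewrite !mxE mulr_suml.
  rewrite exchange_big; apply: eq_bigr => i _ /=.
  under eq_bigr do rewrite mulr_suml.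
  rewrite exchange_big; apply: eq_bigr => j _ /=; apply: eq_bigr => k _; ring.
rewrite !(derive_metric _ _ _ Vz).
rewrite [X in _ + X - _]exchange_big /=.
rewrite [X in _ - X](_ : _ = \sum_i \sum_j \sum_k
   Z 0 k * X 0 i * Y 0 j * 'D_('e_k) (fun y => h y i j) z); last first.
  rewrite exchange_big; apply: eq_bigr => i _ /=; exact: exchange_big.
rewrite -big_split -sumrB mulr_sumr; apply: eq_bigr => i _ /=.
rewrite -big_split -sumrB mulr_sumr; apply: eq_bigr => j _ /=.
rewrite -big_split -sumrB mulr_sumr; apply: eq_bigr => k _ /=.
rewrite /S; ring.
Qed.

Lemma gamma_sym z X Y : V z -> gamma h z X Y = gamma h z Y X.
Proof.
move=> Vz; apply: (inner_inj Vz) => Z.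
rewrite !(koszul _ _ _ Vz) (derive_metric_sym Z X Y Vz); ring.
Qed.

(** The connection is metric: the Koszul terms antisymmetric in [X] and [Y]
    cancel. *)
Lemma gamma_metric z X Y Z : V z ->
  dmetric h z Z X Y =
  inner h z (gamma h z Z X) Y + inner h z X (gamma h z Z Y).
Proof.
move=> Vz; rewrite (inner_sym X _ Vz) !(koszul _ _ _ Vz).
rewrite (derive_metric_sym X Z Y Vz) (derive_metric_sym Z Y X Vz).
rewrite (derive_metric_sym Y Z X Vz).
lra.
Qed.

Lemma smooth_christoffel l i j : smooth_on V (fun z => christoffel h z l i j).
Proof.
have sinv := smooth_invmx oV sh metric_unit.
apply: (smooth_mul oV (smooth_cst _)); apply: (smooth_sum oV) => k _.
have D a b c : smooth_on V ('D_('e_a) (fun y => h y b c)).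
  exact: (smooth_derive oV _ (smooth_metric_coord b c)).
apply: (smooth_mul oV); first exact: smooth_coord.
have := smooth_add oV (smooth_add oV (D i j k) (D j i k))
   (smooth_mul oV (smooth_cst (-1 : R)) (D k i j)).
by apply: eq_smooth => // x _; rewrite mulN1r.
Qed.

Lemma smooth_gamma_cst X Y : smooth_on V (fun z => gamma h z X Y).
Proof.
apply: smooth_mx => // o l; apply: (eq_smooth oV (f := fun z =>
  \sum_i \sum_j christoffel h z l i j * X 0 i * Y 0 j)).
  by move=> z _; rewrite mxE.
apply: smooth_sum => // i _; apply: smooth_sum => // j _.
apply: (smooth_mul oV _ (smooth_cst _)); apply: (smooth_mul oV _ (smooth_cst _)).
exact: smooth_christoffel.
Qed.

(** The fields with constant components commute, so the bracket term of the
    curvature drops out. *)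
Lemma curvatureE z X Y Z :
  curvature h z X Y Z = dgamma h z X Y Z + gamma h z X (gamma h z Y Z)
                      - dgamma h z Y X Z - gamma h z Y (gamma h z X Z).
Proof.
have E A B : nabla h (cst A) (cst B) = fun y => gamma h y A B.
  by apply/funext => y; rewrite /nabla derive_cst add0r.
rewrite /curvature /curvature_fields !E.
have -> : bracket (cst X) (cst Y) = cst 0.
  by apply/funext => y; rewrite /bracket !derive_cst subrr.
by rewrite E gamma0l subr0 dgamma.unlock /nabla opprD !addrA.
Qed.

Lemma dgamma_sym z Z X Y : V z -> dgamma h z Z X Y = dgamma h z Z Y X.
Proof.
rewrite dgamma.unlock => Vz; apply: (eq_derive oV) => // y Vy.
exact: gamma_sym.
Qed.

Section Along.
Context {m : nat} {U : set 'rV[R]_m} {f : 'rV[R]_m -> 'rV[R]_d}.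
Hypothesis Hf : smooth_map U V f.
Let oU := smooth_map_open Hf.
Let sf := smooth_map_smooth Hf.
Let UV := smooth_map_sub Hf.
Implicit Types (A B : 'rV[R]_m -> 'rV[R]_d) (x v w : 'rV[R]_m).

Lemma smooth_inner A B : smooth_on U A -> smooth_on U B ->
  smooth_on U (fun x => inner h (f x) (A x) (B x)).
Proof.
move=> sA sB; apply: (smooth_coord oU); apply: (smooth_mulmx oU).
  by apply: (smooth_mulmx oU) => //; exact: (smooth_comp_mx oU oV UV sf).
exact: smooth_tr.
Qed.

Lemma gamma_terms_smooth A B l i j : smooth_on U A -> smooth_on U B ->
  smooth_on U (fun x => christoffel h (f x) l i j * A x 0 i * B x 0 j).
Proof.
move=> sA sB; apply: (smooth_mul oU); last exact: smooth_coord.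
apply: (smooth_mul oU); last exact: smooth_coord.
exact: (smooth_comp oU oV UV sf (smooth_christoffel l i j)).
Qed.

Lemma smooth_gamma A B : smooth_on U A -> smooth_on U B ->
  smooth_on U (fun x => gamma h (f x) (A x) (B x)).
Proof.
move=> sA sB; apply: smooth_mx => // o l; apply: (eq_smooth oU (f := fun x =>
  \sum_i \sum_j christoffel h (f x) l i j * A x 0 i * B x 0 j)).
  by move=> z _; rewrite mxE.
apply: smooth_sum => // i _; apply: smooth_sum => // j _.
exact: gamma_terms_smooth.
Qed.

(** Product rules for the metric and for the connection evaluated on fields
    along [f]: besides the two fields, the base point moves with velocity
    ['D_v f x]. *)
Lemma derive_inner A B v x : smooth_on U A -> smooth_on U B -> U x ->
  'D_v (fun y => inner h (f y) (A y) (B y)) x =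
  dmetric h (f x) ('D_v f x) (A x) (B x) + inner h (f x) ('D_v A x) (B x)
  + inner h (f x) (A x) ('D_v B x).
Proof.
move=> sA sB Ux.
have shf := smooth_comp_mx oU oV UV sf sh.
have sAh := smooth_mulmx oU sA shf.
have sBt := smooth_tr oU sB.
rewrite -(derive_coord_smooth _ _ _ (smooth_mulmx oU sAh sBt) Ux).
rewrite (derive_mulmx oU _ sAh sBt Ux) (derive_mulmx oU _ sA shf Ux).
rewrite (derive_tr oU _ sB Ux) (derive_compE UV sf _ sh Ux) mulmxDl !mxE.
by rewrite dmetric.unlock /inner [X in X + _]addrC !mxE.
Qed.

Lemma derive_gamma A B v x : smooth_on U A -> smooth_on U B -> U x ->
  'D_v (fun y => gamma h (f y) (A y) (B y)) x =
  dgamma h (f x) ('D_v f x) (A x) (B x) + gamma h (f x) ('D_v A x) (B x)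
  + gamma h (f x) (A x) ('D_v B x).
Proof.
move=> sA sB Ux; apply/rowP => l.
rewrite (derive_coord_smooth _ _ _ (smooth_gamma sA sB) Ux).
transitivity ('D_v (fun y => \sum_i \sum_j
    christoffel h (f y) l i j * A y 0 i * B y 0 j) x).
  by congr ('D_v _ x); apply/funext => y; rewrite mxE.
have sc i j := smooth_christoffel l i j.
have scf i j := smooth_comp oU oV UV sf (sc i j).
have st i j := gamma_terms_smooth l i j sA sB.
rewrite (derive_bigsum _ (fun i => smooth_sum oU _ (fun j _ => st i j)) Ux).
transitivity (\sum_i \sum_j (
   'D_('D_v f x) (fun z => christoffel h z l i j) (f x) * A x 0 i * B x 0 j
   + christoffel h (f x) l i j * 'D_v A x 0 i * B x 0 j
   + christoffel h (f x) l i j * A x 0 i * 'D_v B x 0 j)).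
  apply: eq_bigr => i _.
  rewrite (derive_bigsum _ (fun j => st i j) Ux); apply: eq_bigr => j _.
  have sAi := smooth_coord oU 0 i sA; have sBj := smooth_coord oU 0 j sB.
  rewrite (derive_mul _ (smooth_mul oU (scf i j) sAi) sBj Ux).
  rewrite (derive_mul _ (scf i j) sAi Ux) mulrDl.
  rewrite (derive_compE UV sf _ (sc i j) Ux).
  by rewrite !(derive_coord_smooth _ _ _ _ Ux).
under eq_bigr do rewrite !big_split /=.
rewrite !big_split /= !mxE; congr (_ + _ + _).
rewrite dgamma.unlock (derive_coord_smooth _ _ _ (smooth_gamma_cst _ _) (UV Ux)).
transitivity ('D_('D_v f x) (fun z => \sum_i \sum_j
    christoffel h z l i j * A x 0 i * B x 0 j) (f x)); last first.
  by congr ('D__ _ _); apply/funext => y; rewrite mxE.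
have sct i j : smooth_on V (fun z => christoffel h z l i j * A x 0 i * B x 0 j).
  by apply: (smooth_mul oV _ (smooth_cst _)); exact: (smooth_mul oV _ (smooth_cst _)).
rewrite (derive_bigsum _ (fun i => smooth_sum oV _ (fun j _ => sct i j)) (UV Ux)).
apply: eq_bigr => i _.
rewrite (derive_bigsum _ (fun j => sct i j) (UV Ux)); apply: eq_bigr => j _.
rewrite (derive_mul _ (smooth_mul oV (sc i j) (smooth_cst _)) (smooth_cst _) (UV Ux)).
rewrite (derive_mul _ (sc i j) (smooth_cst _) (UV Ux)).
by rewrite !derive_cst !mulr0 !addr0.
Qed.

End Along.

End LocalMetric.

(** * The pulled-back connection *)
Lemma smooth_map_id (R : realType) d (V : set 'rV[R]_d) : open V -> smooth_map V V id.
Proof.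
move=> oV; split=> // k; case: k => [|k] /=; first by move=> x _; exact: cvg_id.
split=> // a; apply: (eq_Ck oV _ (Ck_cst k V _)) => x _; by rewrite derive_id.
Qed.

(** The pull-back by [f] of the connection of [h], in an arbitrary direction.
    For [f = id] it is the connection of [h] itself, so that one theory serves
    the submanifold and the ambient space. *)
HB.lock Definition cov (R : realType) m d (h : 'rV[R]_d -> 'M[R]_d)
    (f : 'rV[R]_m -> 'rV[R]_d) (v : 'rV[R]_m) (A : 'rV[R]_m -> 'rV[R]_d)
    (x : 'rV[R]_m) : 'rV[R]_d :=
  'D_v A x + gamma h (f x) ('D_v f x) (A x).

Section Covariant.
Context {R : realType} {d : nat} {V : set 'rV[R]_d} {h : 'rV[R]_d -> 'M[R]_d}.
Hypothesis Hh : metric_on V h.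
Context {m : nat} {U : set 'rV[R]_m} {f : 'rV[R]_m -> 'rV[R]_d}.
Hypothesis Hf : smooth_map U V f.
Let oU := smooth_map_open Hf.
Let sf := smooth_map_smooth Hf.
Let UV := smooth_map_sub Hf.
Implicit Types (A B : 'rV[R]_m -> 'rV[R]_d) (x v w : 'rV[R]_m).

Lemma smooth_cov A v : smooth_on U A -> smooth_on U (cov h f v A).
Proof.
move=> sA; rewrite cov.unlock; apply: (smooth_add oU (smooth_derive oU v sA)).
exact: (smooth_gamma Hh Hf (smooth_derive oU v sf) sA).
Qed.

Lemma cov_scale (c : 'rV[R]_m -> R) A v x :
  smooth_on U c -> smooth_on U A -> U x ->
  cov h f v (fun y => c y *: A y) x = 'D_v c x *: A x + c x *: cov h f v A x.
Proof.
by move=> sc sA Ux; rewrite cov.unlock (derive_scale oU v sc sA Ux) gammaZr scalerDr addrA.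
Qed.

Lemma derive_inner_cov A B v x : smooth_on U A -> smooth_on U B -> U x ->
  'D_v (fun y => inner h (f y) (A y) (B y)) x =
  inner h (f x) (cov h f v A x) (B x) + inner h (f x) (A x) (cov h f v B x).
Proof.
move=> sA sB Ux; rewrite (derive_inner Hh Hf v sA sB Ux).
rewrite (gamma_metric Hh _ _ _ (UV Ux)) cov.unlock innerDl innerDr.
ring.
Qed.

(** Second derivatives of [f] commute and the Christoffel symbols are
    symmetric. *)
Lemma cov_torsion_free v w x : U x -> cov h f v ('D_w f) x = cov h f w ('D_v f) x.
Proof.
move=> Ux; rewrite cov.unlock (gamma_sym Hh _ _ (UV Ux)).
exact: (congr1 (fun B : 'rV[R]_d => B + gamma h (f x) ('D_w f x) ('D_v f x))
  (derive_swap_mx oU v w sf Ux)).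
Qed.

(** The second derivatives of [A] and of [f] cancel by symmetry, and so do the
    terms pairing a derivative of [A] with one of [f]; the derivatives and the
    products of the Christoffel symbols remain. *)
Lemma cov_curvature A v w x : smooth_on U A -> U x ->
  cov h f v (cov h f w A) x - cov h f w (cov h f v A) x =
  curvature h (f x) ('D_v f x) ('D_w f x) (A x).
Proof.
move=> sA Ux.
have cancel (a p p' q r s t t' : 'rV[R]_d) :
    a + (p + q + r) + (s + t) - (a + (p' + q + s) + (r + t')) = p + t - p' - t'.
  by apply/rowP => l; rewrite !mxE; ring.
have E a b : cov h f a (cov h f b A) x = 'D_a ('D_b A) x
    + (dgamma h (f x) ('D_a f x) ('D_b f x) (A x)
       + gamma h (f x) ('D_a ('D_b f) x) (A x)
       + gamma h (f x) ('D_b f x) ('D_a A x))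
    + (gamma h (f x) ('D_a f x) ('D_b A x)
       + gamma h (f x) ('D_a f x) (gamma h (f x) ('D_b f x) (A x))).
  have sg := smooth_gamma Hh Hf (smooth_derive oU b sf) sA.
  rewrite cov.unlock (derive_add a (smooth_derive oU b sA) sg Ux).
  by rewrite (derive_gamma Hh Hf a (smooth_derive oU b sf) sA Ux) gammaDr.
rewrite !E curvatureE (derive_swap_mx oU w v sA Ux) (derive_swap_mx oU w v sf Ux).
exact: cancel.
Qed.

End Covariant.

(** * Symmetries of the Riemann tensor *)
Section Curvature.
Context {R : realType} {d : nat} {V : set 'rV[R]_d} {h : 'rV[R]_d -> 'M[R]_d}.
Hypothesis Hh : metric_on V h.
Let oV := metric_on_open Hh.
Let Hid := smooth_map_id oV.
Implicit Types X Y Z W z : 'rV[R]_d.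

Lemma curvature_antisym z X Y Z : curvature h z X Y Z = - curvature h z Y X Z.
Proof.
have anti (a b p q : 'rV[R]_d) : a + b - p - q = - (p + q - a - b).
  by apply/rowP => l; rewrite !mxE; ring.
by rewrite !curvatureE; exact: anti.
Qed.

Lemma curvature_bianchi z X Y Z : V z ->
  curvature h z X Y Z + curvature h z Y Z X + curvature h z Z X Y = 0.
Proof.
move=> Vz; rewrite !curvatureE (dgamma_sym Hh _ X Z Vz) (dgamma_sym Hh _ X Y Vz).
rewrite (dgamma_sym Hh _ Y Z Vz).
rewrite (gamma_sym Hh X Z Vz) (gamma_sym Hh X Y Vz) (gamma_sym Hh Y Z Vz).
have cyc (a b p q r s : 'rV[R]_d) :
    a + b - p - q + (p + q - r - s) + (r + s - a - b) = 0.
  by apply/rowP => l; rewrite !mxE; ring.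
exact: cyc.
Qed.

(** The second derivatives of the function [inner h y Z W] along [X] and [Y]
    commute; expanding both with the metric connection leaves the curvature
    acting on [Z] and on [W]. *)
Lemma curvature_skew z X Y Z W : V z ->
  inner h z (curvature h z X Y Z) W = - inner h z (curvature h z X Y W) Z.
Proof.
move=> Vz.
pose cZ := (fun _ : 'rV[R]_d => Z); pose cW := (fun _ : 'rV[R]_d => W).
have sZ : smooth_on V cZ by exact: smooth_cst.
have sW : smooth_on V cW by exact: smooth_cst.
have sphi : smooth_on V (fun y => inner h y Z W) := smooth_inner Hh Hid sZ sW.
have D1 A y : V y -> 'D_A (fun y => inner h y Z W) y =
    inner h y (cov h id A cZ y) W + inner h y Z (cov h id A cW y).
  by move=> Vy; rewrite (derive_inner_cov Hh Hid A sZ sW Vy).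
have D2 A B : 'D_A ('D_B (fun y => inner h y Z W)) z =
    inner h z (cov h id A (cov h id B cZ) z) W
    + inner h z (cov h id B cZ z) (cov h id A cW z)
    + (inner h z (cov h id A cZ z) (cov h id B cW z)
    + inner h z Z (cov h id A (cov h id B cW) z)).
  rewrite (eq_derive oV A (D1 B) Vz).
  have sBZ := smooth_cov Hh Hid B sZ; have sBW := smooth_cov Hh Hid B sW.
  rewrite (derive_add A (smooth_inner Hh Hid sBZ sW) (smooth_inner Hh Hid sZ sBW) Vz).
  by rewrite (derive_inner_cov Hh Hid A sBZ sW Vz) (derive_inner_cov Hh Hid A sZ sBW Vz).
have CA (A : 'rV[R]_d -> 'rV[R]_d) : smooth_on V A ->
    curvature h z X Y (A z) = cov h id X (cov h id Y A) z - cov h id Y (cov h id X A) z.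
  by move=> sA; rewrite (cov_curvature Hh Hid X Y sA Vz) !derive_id.
have CZ : curvature h z X Y Z = _ := CA cZ sZ.
have CW : curvature h z X Y W = _ := CA cW sW.
rewrite CZ CW !innerBl (inner_sym Hh (cov h id X (cov h id Y cW) z) Z Vz).
rewrite (inner_sym Hh (cov h id Y (cov h id X cW) z) Z Vz).
have rearrange (a1 a2 b c e1 e2 : R) :
  a1 + b + (c + e1) = a2 + c + (b + e2) -> a1 - a2 = - (e1 - e2) by lra.
apply: rearrange (etrans (esym (D2 X Y)) (etrans _ (D2 Y X))).
exact: derive_swap oV (sphi 2) Vz.
Qed.

End Curvature.

HB.lock Definition riem (R : realType) d (h : 'rV[R]_d -> 'M[R]_d)
  (z X Y Z W : 'rV[R]_d) : R := inner h z (curvature h z X Y Z) W.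

Section ConstantFields.
Context {R : realType} {d : nat} {V : set 'rV[R]_d} {h : 'rV[R]_d -> 'M[R]_d}.
Hypothesis Hh : metric_on V h.
Let Hid := smooth_map_id (metric_on_open Hh).
Implicit Types z Z A B : 'rV[R]_d.

Lemma derive_inner_cst z Z A B : V z ->
  'D_Z (fun y => inner h y A B) z = dmetric h z Z A B.
Proof.
move=> Vz.
have sA : smooth_on V (fun _ => A) by exact: smooth_cst.
have sB : smooth_on V (fun _ => B) by exact: smooth_cst.
by rewrite (derive_inner Hh Hid Z sA sB Vz) derive_id !derive_cst inner0l inner0r !addr0.
Qed.

End ConstantFields.

Section Riem.
Context {R : realType} {d : nat} {V : set 'rV[R]_d} {h : 'rV[R]_d -> 'M[R]_d}.
Hypothesis Hh : metric_on V h.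
Context (z : 'rV[R]_d) (Vz : V z).
Implicit Types X Y Z W : 'rV[R]_d.

Lemma riemDr X Y Z W W' : riem h z X Y Z (W + W') = riem h z X Y Z W + riem h z X Y Z W'.
Proof. by rewrite riem.unlock innerDr. Qed.

Lemma riem12 X Y Z W : riem h z X Y Z W = - riem h z Y X Z W.
Proof. by rewrite riem.unlock curvature_antisym innerNl. Qed.

Lemma riem34 X Y Z W : riem h z X Y Z W = - riem h z X Y W Z.
Proof. by rewrite riem.unlock; exact: (curvature_skew Hh). Qed.

Lemma riem_bianchi X Y Z W :
  riem h z X Y Z W + riem h z Y Z X W + riem h z Z X Y W = 0.
Proof.
by rewrite riem.unlock -!innerDl (curvature_bianchi Hh) // inner0l.
Qed.

Lemma riem_pair_sym X Y Z W : riem h z X Y Z W = riem h z Z W X Y.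
Proof. exact: (curvature_pair_sym riem12 riem34 riem_bianchi). Qed.

End Riem.

(** * Kaehler metrics *)

(** Here [J] has constant entries, as it does in holomorphic coordinates; the
    last condition says that the fundamental form is closed. *)
Record kahler_on (R : realType) d (V : set 'rV[R]_d) (h : 'rV[R]_d -> 'M[R]_d)
    (J : 'M[R]_d) : Prop := KahlerOn {
  kahler_on_metric : metric_on V h ;
  kahler_on_J2 : J *m J = - 1%:M ;
  kahler_on_hermitian : forall z, V z -> forall X Y : 'rV[R]_d,
    inner h z (X *m J) (Y *m J) = inner h z X Y ;
  kahler_on_closed : forall z, V z -> forall a b k : 'I_d,
    'D_('e_a) (fun y => inner h y ('e_b *m J) 'e_k) z
    + 'D_('e_b) (fun y => inner h y ('e_k *m J) 'e_a) z
    + 'D_('e_k) (fun y => inner h y ('e_a *m J) 'e_b) z = 0 }.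

Section Kahler.
Context {R : realType} {d : nat} {V : set 'rV[R]_d} {h : 'rV[R]_d -> 'M[R]_d}.
Context {J : 'M[R]_d}.
Hypothesis HK : kahler_on V h J.
Let Hh := kahler_on_metric HK.
Let oV := metric_on_open Hh.
Let sh := metric_on_smooth Hh.
Let herm := kahler_on_hermitian HK.
Implicit Types X Y Z W z A B : 'rV[R]_d.

Lemma mulJJ X : X *m J *m J = - X.
Proof. by rewrite -mulmxA (kahler_on_J2 HK) mulmxN mulmx1. Qed.

Lemma inner_Jl z X Y : V z -> inner h z (X *m J) Y = - inner h z X (Y *m J).
Proof. by move=> Vz; rewrite -(herm Vz) mulJJ innerNl. Qed.

Lemma dmetric_sum1 z Z A B : V z ->
  dmetric h z Z A B = \sum_a Z 0 a * dmetric h z 'e_a A B.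
Proof.
move=> Vz; rewrite dmetric.unlock {1}/inner.
rewrite derive_sum_basis; last exact: smooth_differentiable sh Vz.
rewrite mulmx_sumr mulmx_suml summxE; apply: eq_bigr => a _.
by rewrite -scalemxAr -scalemxAl mxE.
Qed.

Lemma dmetric_sum3 z Z A B : dmetric h z Z A B = \sum_a B 0 a * dmetric h z Z A 'e_a.
Proof.
rewrite dmetric.unlock {1}(row_sum_delta B) inner_sumr.
by apply: eq_bigr => a _; rewrite innerZr.
Qed.

Lemma dmetric_sumJ z X Y Z : V z -> dmetric h z X (Y *m J) Z =
  \sum_a \sum_b \sum_k X 0 a * Y 0 b * Z 0 k * dmetric h z 'e_a ('e_b *m J) 'e_k.
Proof.
move=> Vz; rewrite dmetric_sum1//; apply: eq_bigr => a _.
have -> : Y *m J = \sum_b Y 0 b *: ('e_b *m J).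
  by rewrite {1}(row_sum_delta Y) mulmx_suml; apply: eq_bigr => b _; rewrite scalemxAl.
rewrite [dmetric _ _ _ _ _](_ : _ =
  \sum_b Y 0 b * dmetric h z 'e_a ('e_b *m J) Z); last first.
  by rewrite dmetric.unlock inner_suml; apply: eq_bigr => b _; rewrite innerZl.
rewrite mulr_sumr; apply: eq_bigr => b _; rewrite dmetric_sum3 !mulr_sumr.
by apply: eq_bigr => k _; rewrite !mulrA.
Qed.

(** Each term is trilinear, and closedness is known on basis vectors. *)
Lemma dmetric_closed z X Y Z : V z ->
  dmetric h z X (Y *m J) Z + dmetric h z Y (Z *m J) X + dmetric h z Z (X *m J) Y = 0.
Proof.
move=> Vz; rewrite !dmetric_sumJ //.
have closed a b k := kahler_on_closed HK Vz a b k.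
rewrite [X in _ + X + _](_ : _ = \sum_a \sum_b \sum_k
  X 0 a * Y 0 b * Z 0 k * dmetric h z 'e_b ('e_k *m J) 'e_a); last first.
  rewrite [RHS]exchange_big; apply: eq_bigr => b _ /=.
  rewrite [RHS]exchange_big; apply: eq_bigr => k _ /=.
  by apply: eq_bigr => a _; congr (_ * _); ring.
rewrite [X in _ + X](_ : _ = \sum_a \sum_b \sum_k
  X 0 a * Y 0 b * Z 0 k * dmetric h z 'e_k ('e_a *m J) 'e_b); last first.
  rewrite exchange_big; apply: eq_bigr => a _ /=.
  rewrite exchange_big; apply: eq_bigr => b _ /=.
  by apply: eq_bigr => k _; congr (_ * _); ring.
rewrite -!big_split big1 // => a _; rewrite -!big_split big1 // => b _.
rewrite -!big_split big1 // => k _.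
by rewrite /= -!mulrDr -!(derive_inner_cst Hh) // closed mulr0.
Qed.

Lemma dmetric_J z Z A B : V z ->
  dmetric h z Z (A *m J) (B *m J) = dmetric h z Z A B.
Proof.
move=> Vz; rewrite -!(derive_inner_cst Hh) //; apply: (eq_derive oV) => // y Vy.
exact: herm.
Qed.

Lemma dmetric_Jl z Z A B : V z -> dmetric h z Z (A *m J) B = - dmetric h z Z A (B *m J).
Proof. by move=> Vz; rewrite -(dmetric_J Z _ B)// mulJJ dmetric.unlock innerNl. Qed.

(** The complex structure is parallel. By Koszul, the defect paired with [Z] is
    half the difference of the closedness relations at [(X, Y, Z)] and at
    [(X, J Y, J Z)], up to the invariance of the metric under [J]. *)
Lemma gammaJ z X Y : V z -> gamma h z X (Y *m J) = gamma h z X Y *m J.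
Proof.
move=> Vz; apply: (inner_inj Hh Vz) => Z.
rewrite inner_Jl// !(koszul Hh _ _ _ Vz).
have c1 := dmetric_closed X Y Z Vz; have c2 := dmetric_closed X (Y *m J) (Z *m J) Vz.
rewrite !mulJJ (dmetric_J _ X Y Vz) in c2.
have NN A B C : dmetric h z A (- B) C = - dmetric h z A B C.
  by rewrite dmetric.unlock innerNl.
rewrite !NN in c2.
have e1 := dmetric_Jl X Y Z Vz.
have e2 := derive_metric_sym Hh (Y *m J) X Z Vz.
have e3 := derive_metric_sym Hh Z X (Y *m J) Vz.
have e4 := dmetric_Jl Z X Y Vz.
have e5 := dmetric_Jl Y Z X Vz.
have e6 := derive_metric_sym Hh Y X (Z *m J) Vz.
have e7 := dmetric_Jl Y Z X Vz.
lra.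
Qed.

Lemma dgammaJ z Z X Y : V z -> dgamma h z Z X (Y *m J) = dgamma h z Z X Y *m J.
Proof.
move=> Vz; rewrite dgamma.unlock.
rewrite (eq_derive oV (g := fun y => gamma h y X Y *m J))//; last first.
  by move=> y Vy; exact: gammaJ.
have sJ : smooth_on V (fun _ : 'rV[R]_d => J) by exact: smooth_cst.
rewrite (derive_mulmx oV Z (smooth_gamma_cst Hh X Y) sJ Vz).
by rewrite derive_cst mulmx0 addr0.
Qed.

Lemma curvatureJ z X Y Z : V z -> curvature h z X Y (Z *m J) = curvature h z X Y Z *m J.
Proof.
by move=> Vz; rewrite !curvatureE !dgammaJ// !gammaJ// !mulmxBl !mulmxDl.
Qed.

Lemma riemJ z X Y Z W : V z -> riem h z X Y (Z *m J) (W *m J) = riem h z X Y Z W.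
Proof. by move=> Vz; rewrite riem.unlock curvatureJ// herm. Qed.

End Kahler.

Section SpaceForm.
Context {R : realType} {d : nat} {V : set 'rV[R]_d} {h : 'rV[R]_d -> 'M[R]_d}.
Context {J : 'M[R]_d} {c : R}.
Hypothesis HK : kahler_on V h J.
Let Hh := kahler_on_metric HK.
Hypothesis holc : forall z, V z -> forall X : 'rV[R]_d, X != 0 ->
  sectional_curvature h z X (X *m J) = c.

(** The sectional curvature of the plane spanned by [A] and [A *m J] has
    denominator the square of [inner h z A A], since these vectors are
    orthogonal and of equal length. *)
Lemma riem_space_form z X Y Z W : V z ->
  riem h z X Y Z W = space_form_tensor (fun X => X *m J) (inner h z) c X Y Z W.
Proof.
move=> Vz; apply: space_form_tensorE.
- by move=> A B; rewrite mulmxDl.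
- exact: (mulJJ HK).
- exact: riemDr.
- exact: riem12.
- exact: (riem34 Hh).
- exact: (riem_bianchi Hh).
- by move=> A B C D; exact: (riemJ HK).
- exact: innerDr.
- by move=> A B; exact: (inner_sym Hh).
- exact: (kahler_on_hermitian HK).
move=> A; have [->|A0] := eqVneq A 0.
  by rewrite inner0l expr0n mulr0 riem.unlock inner0r.
have AJ : inner h z A (A *m J) = 0.
  have := inner_Jl HK A A Vz; rewrite (inner_sym Hh (A *m J) A Vz).
  by move: (inner _ _ _ _) => a; lra.
have := holc Vz A0; rewrite /sectional_curvature -/(inner _ _ _ _).
rewrite (kahler_on_hermitian HK Vz) AJ expr0n subr0 riem.unlock => <-.
have : inner h z A A != 0 by rewrite gt_eqF // (metric_on_pos Hh).
move: (inner h z A A) (inner h z _ A) => a b a0.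
by field.
Qed.

End SpaceForm.

(** * First order geometry of an isometric immersion *)
Lemma nabla_alongE (R : realType) m d (h : 'rV[R]_d -> 'M[R]_d)
    (f : 'rV[R]_m -> 'rV[R]_d) (a : 'I_m) A : nabla_along h f a A = cov h f 'e_a A.
Proof. by rewrite cov.unlock. Qed.

Lemma inner_delta (R : realType) m (g : 'rV[R]_m -> 'M[R]_m) x a b :
  inner g x 'e_a 'e_b = g x a b.
Proof. by rewrite /inner -rowE trmx_delta -colE !mxE. Qed.

Lemma gamma_delta (R : realType) m (g : 'rV[R]_m -> 'M[R]_m) x a b k :
  gamma g x 'e_a 'e_b 0 k = christoffel g x k a b.
Proof.
rewrite mxE (bigD1 a) //= (bigD1 b) //= !mxE !eqxx /= !mulr1.
rewrite big1 => [|j /negbTE jb]; last by rewrite mxE /= jb mulr0.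
rewrite addr0 big1 => [|i /negbTE ia]; first by rewrite addr0.
by rewrite big1 // => j _; rewrite mxE /= ia mulr0 mul0r.
Qed.

Definition christoffel_mx (R : realType) m (g : 'rV[R]_m -> 'M[R]_m) x
    (c : 'I_m) : 'M[R]_m :=
  \matrix_(a, k) christoffel g x k c a.

Definition normal_to (R : realType) m d (h : 'rV[R]_d -> 'M[R]_d)
    (f : 'rV[R]_m -> 'rV[R]_d) x (W : 'rV[R]_d) : Prop :=
  forall c, inner h (f x) W ('D_('e_c) f x) = 0.

Section Immersion.
Context {R : realType} {m d : nat} {V : set 'rV[R]_d} {U : set 'rV[R]_m}.
Context {h : 'rV[R]_d -> 'M[R]_d} {g : 'rV[R]_m -> 'M[R]_m}.
Context {f : 'rV[R]_m -> 'rV[R]_d}.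
Hypothesis Hh : metric_on V h.
Hypothesis Hg : metric_on U g.
Hypothesis Hf : smooth_map U V f.
Hypothesis iso : forall x, U x -> forall X Y : 'rV[R]_m,
  inner h (f x) ('D_X f x) ('D_Y f x) = inner g x X Y.
Let oU := metric_on_open Hg.
Let UV := smooth_map_sub Hf.
Let sg := metric_on_smooth Hg.
Local Notation F a := ('D_('e_a) f).
Local Notation ip x := (inner h (f x)).
Local Notation nab a := (cov h f 'e_a).
Local Notation G x := (invmx (g x)).
Local Notation Gam x := (christoffel g x).
Implicit Types (x : 'rV[R]_m) (a b c k l : 'I_m) (W : 'rV[R]_d).

Lemma smooth_frame a : smooth_on U (F a).
Proof. exact: (smooth_derive oU _ (smooth_map_smooth Hf)). Qed.

Lemma first_form x a b : U x -> ip x (F a x) (F b x) = g x a b.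
Proof. by move=> Ux; rewrite (iso Ux) inner_delta. Qed.

Lemma christoffel_sym x k a b : U x -> Gam x k a b = Gam x k b a.
Proof. by move=> Ux; rewrite -!gamma_delta (gamma_sym Hg). Qed.

Lemma inner_christoffel x a b c : U x ->
  inner g x (gamma g x 'e_a 'e_b) 'e_c = \sum_k Gam x k a b * g x k c.
Proof.
move=> Ux; rewrite {1}(row_sum_delta (gamma _ _ _ _)) inner_suml.
by apply: eq_bigr => k _; rewrite innerZl inner_delta gamma_delta.
Qed.

Lemma derive_first_form x a b c : U x -> 'D_('e_a) (fun y => g y b c) x =
  ip x (nab a (F b) x) (F c x) + ip x (F b x) (nab a (F c) x).
Proof.
move=> Ux; rewrite -(derive_inner_cov Hh Hf 'e_a (smooth_frame b) (smooth_frame c) Ux).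
by apply: (eq_derive oU) => // y Uy; rewrite first_form.
Qed.

(** Gauss formula. The tangential components of the derivative of the frame
    satisfy the identities that characterise the Christoffel symbols of the
    induced metric: they are symmetric, and they recover its derivatives. *)
Lemma gauss_tangent x a b c : U x ->
  ip x (nab a (F b) x) (F c x) = \sum_k Gam x k a b * g x k c.
Proof.
move=> Ux; rewrite -inner_christoffel// (koszul Hg _ _ _ Ux).
have [q qE] : exists q, forall i j k, q i j k = ip x (nab i (F j) x) (F k x).
  by exists (fun i j k => ip x (nab i (F j) x) (F k x)).
have qsym i j k : q i j k = q j i k.
  by rewrite !qE (cov_torsion_free Hh Hf 'e_i 'e_j Ux).
have E i j k : dmetric g x 'e_i 'e_j 'e_k = q i j k + q i k j.
  rewrite -(derive_inner_cst Hg)//.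
  rewrite (_ : (fun y => _) = fun y => g y j k); last first.
    by apply/funext => y; rewrite inner_delta.
  by rewrite derive_first_form// (inner_sym Hh (F j x)) ?qE//; exact: UV.
rewrite -qE !E (qsym b a) (qsym c a) (qsym c b).
by field.
Qed.

Lemma derive_first_form_christoffel x a b c : U x ->
  'D_('e_a) (fun y => g y b c) x =
  \sum_k Gam x k a b * g x k c + \sum_k Gam x k a c * g x b k.
Proof.
move=> Ux; rewrite derive_first_form// (inner_sym Hh (F b x) _ (UV Ux)).
rewrite !(gauss_tangent _ _ _ Ux); congr (_ + _); apply: eq_bigr => k _.
by rewrite -[in g x b k](metric_on_sym Hg Ux) mxE.
Qed.

Lemma inverse_metric_sym x a b : U x -> G x a b = G x b a.
Proof.
move=> Ux; have : (G x)^T = G x by rewrite trmx_inv (metric_on_sym Hg).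
by move=> /matrixP/(_ a b); rewrite mxE.
Qed.

Lemma smooth_inverse_metric : smooth_on U (fun x => G x).
Proof. exact: (smooth_invmx oU sg (fun x Ux => metric_unit Hg Ux)). Qed.

(** Differentiate the product of the metric with its inverse. *)
Lemma derive_inverse_metric x c : U x ->
  'D_('e_c) (fun y => G y) x =
  - (G x *m christoffel_mx g x c) - (christoffel_mx g x c)^T *m G x.
Proof.
move=> Ux; set P := christoffel_mx g x c.
have uG := metric_unit Hg Ux.
have Dg : 'D_('e_c) g x = P *m g x + g x *m P^T.
  apply/matrixP => a b; rewrite (derive_coord_smooth _ _ _ sg Ux).
  rewrite derive_first_form_christoffel// !mxE; congr (_ + _).
    by apply: eq_bigr => k _; rewrite mxE.
  by apply: eq_bigr => k _; rewrite !mxE mulrC.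
have E : 'D_('e_c) (fun y => G y) x *m g x + G x *m 'D_('e_c) g x = 0.
  rewrite -(derive_mulmx oU 'e_c smooth_inverse_metric sg Ux).
  rewrite (eq_derive oU (g := fun _ => 1%:M))// ?derive_cst// => y Uy.
  by rewrite mulVmx// (metric_unit Hg).
rewrite Dg mulmxDr (mulmxA _ (g x)) mulVmx// mul1mx mulmxA in E.
have := congr1 (fun A => A *m G x) E; rewrite !mulmxDl mul0mx.
rewrite -!(mulmxA _ (g x)) mulmxV// !mulmx1 => /eqP.
by rewrite addr_eq0 => /eqP ->; rewrite opprD.
Qed.

Lemma tangent_part_inner x W c : U x ->
  ip x (tangent_part g h f x W) (F c x) = ip x W (F c x).
Proof.
move=> Ux; rewrite /tangent_part /trace_wrt inner_suml.
transitivity (\sum_a \sum_b G x a b * g x b c * ip x W (F a x)).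
  apply: eq_bigr => a _; rewrite inner_suml; apply: eq_bigr => b _.
  by rewrite !innerZl first_form//; ring.
transitivity (\sum_a (a == c)%:R * ip x W (F a x)).
  apply: eq_bigr => a _; rewrite -mulr_suml; congr (_ * _).
  have /matrixP/(_ a c) := mulVmx (metric_unit Hg Ux).
  by rewrite !mxE.
rewrite (bigD1 c) //= eqxx mul1r big1 ?addr0// => a /negbTE ->.
by rewrite mul0r.
Qed.

Lemma tangent_part_eq0 x W : U x -> tangent_part g h f x W = 0 <-> normal_to h f x W.
Proof.
move=> Ux; split => [W0 c|W0].
  by rewrite -tangent_part_inner// W0 inner0l.
by rewrite /tangent_part /trace_wrt big1// => a _; rewrite big1// => b _;
   rewrite W0 scale0r scaler0.
Qed.

Lemma tangent_normal x W N : normal_to h f x N -> U x ->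
  ip x (tangent_part g h f x W) N = 0.
Proof.
move=> N0 Ux; rewrite /tangent_part /trace_wrt inner_suml big1// => a _.
rewrite inner_suml big1// => b _; rewrite !innerZl.
by rewrite (inner_sym Hh _ N (UV Ux)) N0 !mulr0.
Qed.

Lemma second_fundamental_formE a b x :
  second_fundamental_form g h f a b x = nab a (F b) x - \sum_k Gam x k a b *: F k x.
Proof. by rewrite -nabla_alongE. Qed.

(** The Christoffel term removes exactly the tangential part found by
    [gauss_tangent]. *)
Lemma second_fundamental_form_normal a b x : U x ->
  normal_to h f x (second_fundamental_form g h f a b x).
Proof.
move=> Ux c; rewrite second_fundamental_formE innerBl gauss_tangent//.
rewrite inner_suml -sumrB big1// => k _.
by rewrite innerZl first_form// subrr.
Qed.

Lemma smooth_second_fundamental_form a b : smooth_on U (second_fundamental_form g h f a b).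
Proof.
apply: (eq_smooth oU (fun x _ => esym (second_fundamental_formE a b x))).
apply: (smooth_add oU (smooth_cov Hh Hf _ (smooth_frame b))).
apply: (smooth_opp oU); apply: (smooth_sum oU) => k _.
exact: (smooth_scale oU (smooth_christoffel Hg k a b) (smooth_frame k)).
Qed.

Lemma tensionE x :
  tension g h f x = \sum_a \sum_b G x a b *: second_fundamental_form g h f a b x.
Proof. by []. Qed.

Lemma smooth_tension : smooth_on U (tension g h f).
Proof.
apply: (eq_smooth oU (f := fun x =>
  \sum_a \sum_b G x a b *: second_fundamental_form g h f a b x)).
  by move=> x _; rewrite tensionE.
apply: (smooth_sum oU) => a _; apply: (smooth_sum oU) => b _.
apply: (smooth_scale oU _ (smooth_second_fundamental_form a b)).
exact: (smooth_coord oU _ _ smooth_inverse_metric).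
Qed.

Lemma tension_normal x : U x -> normal_to h f x (tension g h f x).
Proof.
move=> Ux c; rewrite tensionE inner_suml big1// => a _; rewrite inner_suml big1// => b _.
by rewrite innerZl second_fundamental_form_normal// mulr0.
Qed.

End Immersion.

(** * Parallel normal fields *)
HB.lock Definition hessian_along (R : realType) m d (g : 'rV[R]_m -> 'M[R]_m)
    (h : 'rV[R]_d -> 'M[R]_d) (f A : 'rV[R]_m -> 'rV[R]_d) (a b : 'I_m)
    (x : 'rV[R]_m) : 'rV[R]_d :=
  cov h f 'e_a (cov h f 'e_b A) x
  - \sum_k christoffel g x k a b *: cov h f 'e_k A x.

(** The second fundamental form in the direction of the field [tau]. The
    tangential part of the derivative of a frame vector does not contribute
    when [tau] is normal. *)
Definition shape_mx (R : realType) m d (h : 'rV[R]_d -> 'M[R]_d)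
    (f tau : 'rV[R]_m -> 'rV[R]_d) (x : 'rV[R]_m) : 'M[R]_m :=
  \matrix_(b, c) inner h (f x) (tau x) (cov h f 'e_b ('D_('e_c) f) x).

Section ParallelNormal.
Context {R : realType} {m d : nat} {V : set 'rV[R]_d} {U : set 'rV[R]_m}.
Context {h : 'rV[R]_d -> 'M[R]_d} {g : 'rV[R]_m -> 'M[R]_m}.
Context {f : 'rV[R]_m -> 'rV[R]_d}.
Hypothesis Hh : metric_on V h.
Hypothesis Hg : metric_on U g.
Hypothesis Hf : smooth_map U V f.
Hypothesis iso : forall x, U x -> forall X Y : 'rV[R]_m,
  inner h (f x) ('D_X f x) ('D_Y f x) = inner g x X Y.
Let oU := metric_on_open Hg.
Let UV := smooth_map_sub Hf.
Let sF := smooth_frame Hg Hf.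
Local Notation F a := ('D_('e_a) f).
Local Notation ip x := (inner h (f x)).
Local Notation nab a := (cov h f 'e_a).
Local Notation G x := (invmx (g x)).
Local Notation Gam x := (christoffel g x).
Implicit Types (x : 'rV[R]_m) (a b c k l : 'I_m) (W : 'rV[R]_d).

Variable tau : 'rV[R]_m -> 'rV[R]_d.
Hypothesis tau_smooth : smooth_on U tau.
Hypothesis tau_normal : forall x, U x -> normal_to h f x (tau x).
Hypothesis tau_parallel : forall x a W, U x -> normal_to h f x W ->
  ip x (nab a tau x) W = 0.

Local Notation S := (shape_mx h f tau).

Lemma smooth_shape : smooth_on U S.
Proof.
apply: (smooth_mx oU) => b c.
apply: (eq_smooth oU _ (smooth_inner Hh Hf tau_smooth (smooth_cov Hh Hf 'e_b (sF c)))).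
by move=> x _; rewrite mxE.
Qed.

Lemma shape_sym x b c : U x -> S x b c = S x c b.
Proof. by move=> Ux; rewrite !mxE (cov_torsion_free Hh Hf 'e_b 'e_c Ux). Qed.

(** Weingarten: differentiate the vanishing product of [tau] with the frame. *)
Lemma inner_nabla_frame x b c : U x -> ip x (nab b tau x) (F c x) = - S x b c.
Proof.
move=> Ux; rewrite mxE.
have := derive_inner_cov Hh Hf 'e_b tau_smooth (sF c) Ux.
rewrite (eq_derive oU (g := fun _ => 0)) ?derive_cst//; last first.
  by move=> y Uy; rewrite (tau_normal Uy).
by move=> /esym/eqP; rewrite addr_eq0 => /eqP.
Qed.

(** As [tau] is parallel in the normal bundle, its derivatives are tangent, so
    they only see the tangential part of the derivatives of the frame. *)
Lemma nabla_tangent x b a c : U x ->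
  ip x (nab b tau x) (nab a (F c) x) = - \sum_k Gam x k a c * S x b k.
Proof.
move=> Ux; have := tau_parallel b Ux (second_fundamental_form_normal Hh Hg Hf iso a c Ux).
rewrite second_fundamental_formE innerBr inner_sumr => /eqP; rewrite subr_eq0 => /eqP ->.
rewrite -sumrN; apply: eq_bigr => k _.
by rewrite innerZr inner_nabla_frame// mulrN.
Qed.

Local Notation nabla2 := (hessian_along g h f tau).

(** The tangential part of the second derivative of [tau] is, up to sign, the
    covariant derivative of the shape form. *)
Lemma nabla2_frame x a b c : U x ->
  ip x (nabla2 a b x) (F c x) = - ('D_('e_a) S x b c
    - \sum_k Gam x k a c * S x b k - \sum_k Gam x k a b * S x k c).
Proof.
move=> Ux; rewrite hessian_along.unlock innerBl inner_suml.
have E : \sum_k ip x (Gam x k a b *: nab k tau x) (F c x) =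
    \sum_k - (Gam x k a b * S x k c).
  by apply: eq_bigr => k _; rewrite innerZl inner_nabla_frame// mulrN.
have := derive_inner_cov Hh Hf 'e_a (smooth_cov Hh Hf 'e_b tau_smooth) (sF c) Ux.
rewrite nabla_tangent// => /esym/eqP; rewrite subr_eq => /eqP ->.
rewrite (eq_derive oU (g := fun y => (- 1) * S y b c))//; last first.
  by move=> y Uy; rewrite inner_nabla_frame// mulN1r.
have sbc := smooth_coord oU b c smooth_shape.
rewrite (derive_mul _ (smooth_cst _) sbc Ux) derive_cst mul0r add0r mulN1r.
rewrite -(derive_coord_smooth _ _ _ smooth_shape Ux).
by rewrite E sumrN !opprD !opprK.
Qed.

Lemma derive_shape_sym x a b c : U x -> 'D_('e_a) S x b c = 'D_('e_a) S x c b.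
Proof.
move=> Ux; rewrite !(derive_coord_smooth _ _ _ smooth_shape Ux).
by apply: (eq_derive oU) => // y Uy; exact: shape_sym.
Qed.

Lemma nabla2_frame_sym x a b c : U x ->
  ip x (nabla2 a b x) (F c x) = ip x (nabla2 a c x) (F b x).
Proof.
move=> Ux; apply: etrans (nabla2_frame a b c Ux) _.
apply: etrans _ (esym (nabla2_frame a c b Ux)); rewrite (derive_shape_sym a b c Ux).
rewrite addrAC; congr (- (_ - _ - _)); apply: eq_bigr => k _; by rewrite shape_sym.
Qed.

(** Ricci identity. Together with [nabla2_frame_sym] it replaces the Codazzi
    equation. *)
Lemma nabla2_commutator x a c W : U x ->
  ip x (nabla2 a c x) W = ip x (nabla2 c a x) W + riem h (f x) (F a x) (F c x) (tau x) W.
Proof.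
move=> Ux; rewrite riem.unlock -(cov_curvature Hh Hf 'e_a 'e_c tau_smooth Ux).
rewrite -innerDl; congr (inner _ _ _ _); rewrite hessian_along.unlock.
rewrite (eq_bigr (fun k => Gam x k c a *: nab k tau x)); last first.
  by move=> k _; rewrite (christoffel_sym Hg).
by rewrite [RHS]addrC addrA subrK.
Qed.

Hypothesis shape_trace : forall x, U x -> \tr (G x *m S x) = ip x (tau x) (tau x).

Lemma derive_norm_tau x c : U x -> 'D_('e_c) (fun y => ip y (tau y) (tau y)) x = 0.
Proof.
move=> Ux; rewrite (derive_inner_cov Hh Hf 'e_c tau_smooth tau_smooth Ux).
have E := tau_parallel c Ux (tau_normal Ux).
by rewrite (inner_sym Hh (tau x) _ (UV Ux)) E addr0.
Qed.

(** The trace of the covariant derivative of the shape form is the derivative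
    of its trace, as the metric is parallel; and this trace, the squared
    length of [tau], is constant because [tau] is parallel. *)
Lemma trace_nabla2_frame x c : U x ->
  \sum_a \sum_b G x a b * ip x (nabla2 c a x) (F b x) = 0.
Proof.
move=> Ux; set P := christoffel_mx g x c.
have sGi := smooth_inverse_metric Hg.
have sGS := smooth_mulmx oU sGi smooth_shape.
have D0 : \tr ('D_('e_c) (fun y => G y *m S y) x) = 0.
  have sT : smooth_on U (fun y => \tr (G y *m S y)).
    by apply: (smooth_sum oU) => i _; exact: (smooth_coord oU i i sGS).
  transitivity ('D_('e_c) (fun y => \tr (G y *m S y)) x).
    rewrite /mxtrace (derive_bigsum 'e_c (fun i => smooth_coord oU i i sGS) Ux).
    by apply: eq_bigr => i _; rewrite (derive_coord_smooth _ _ _ sGS Ux).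
  rewrite (eq_derive oU (g := fun y => ip y (tau y) (tau y)))//.
  exact: derive_norm_tau.
rewrite (derive_mulmx oU _ sGi smooth_shape Ux) in D0.
rewrite (derive_inverse_metric Hh Hg Hf iso _ Ux) -/P in D0.
rewrite (_ : \sum_a _ = - \tr (G x *m ('D_('e_c) S x - S x *m P^T - P *m S x))); last first.
  rewrite /mxtrace -sumrN exchange_big; apply: eq_bigr => b _ /=.
  rewrite mxE -sumrN; apply: eq_bigr => a _.
  rewrite (inverse_metric_sym Hg a b Ux) nabla2_frame// mulrN; congr (- (_ * _)).
  rewrite !mxE; congr (_ - _ - _); apply: eq_bigr => k _; first by rewrite !mxE mulrC.
  by rewrite !mxE.
rewrite mxtraceD mulmxBl mulNmx raddfB raddfN /= in D0.
rewrite -!mulmxA [\tr (P^T *m _)]mxtrace_mulC in D0.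
apply/eqP; rewrite oppr_eq0; apply/eqP.
rewrite -[RHS]D0 !mulmxBr !raddfB /= -!mulmxA.
ring.
Qed.

(** Exchange the last two slots by symmetry of the shape form and then the
    first two by the Ricci identity: what is left besides the curvature is the
    vanishing trace of [trace_nabla2_frame]. *)
Lemma trace_nabla2_tangent x c : U x ->
  \sum_a \sum_b G x a b * ip x (nabla2 a b x) (F c x) =
  \sum_a \sum_b G x a b * riem h (f x) (F a x) (F c x) (tau x) (F b x).
Proof.
move=> Ux; rewrite -[RHS]add0r -[X in X + _](trace_nabla2_frame c Ux) -big_split.
apply: eq_bigr => a _; rewrite -big_split; apply: eq_bigr => b _ /=.
by rewrite (nabla2_frame_sym a b c Ux) (nabla2_commutator a c _ Ux) mulrDr.
Qed.

(** Symmetry by pairs of the Riemann tensor and symmetry of the metric. *)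
Lemma trace_curvature_term x c : U x ->
  \sum_a \sum_b G x a b * riem h (f x) (F a x) (tau x) (F b x) (F c x) =
  - \sum_a \sum_b G x a b * riem h (f x) (F a x) (F c x) (tau x) (F b x).
Proof.
move=> Ux; rewrite [LHS]exchange_big -sumrN; apply: eq_bigr => b _ /=.
rewrite -sumrN; apply: eq_bigr => a _; rewrite -mulrN; congr (_ * _).
  exact: (inverse_metric_sym Hg).
apply: etrans (riem_pair_sym Hh (UV Ux) _ _ _ _) _.
exact: (riem34 Hh (UV Ux)).
Qed.

End ParallelNormal.

(** * The tangential part of the bitension field *)
Lemma hessian_alongE (R : realType) m d (g : 'rV[R]_m -> 'M[R]_m)
    (h : 'rV[R]_d -> 'M[R]_d) (f A : 'rV[R]_m -> 'rV[R]_d) a b x :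
  nabla2_along g h f A a b x = hessian_along g h f A a b x.
Proof.
by rewrite hessian_along.unlock cov.unlock.
Qed.

Section Reduction.
Context {R : realType} {m d : nat} {V : set 'rV[R]_d} {U : set 'rV[R]_m}.
Context {h : 'rV[R]_d -> 'M[R]_d} {g : 'rV[R]_m -> 'M[R]_m}.
Context {f : 'rV[R]_m -> 'rV[R]_d}.
Hypothesis Hh : metric_on V h.
Hypothesis Hg : metric_on U g.
Hypothesis Hf : smooth_map U V f.
Hypothesis iso : forall x, U x -> forall X Y : 'rV[R]_m,
  inner h (f x) ('D_X f x) ('D_Y f x) = inner g x X Y.
Let UV := smooth_map_sub Hf.
Local Notation F a := ('D_('e_a) f).
Local Notation ip x := (inner h (f x)).
Local Notation nab a := (cov h f 'e_a).
Local Notation G x := (invmx (g x)).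
Local Notation tau := (tension g h f).
Implicit Types (x : 'rV[R]_m) (a b c k l : 'I_m) (W : 'rV[R]_d).

(** The difference is normal and orthogonal to itself. *)
Lemma normal_tangent_part0 x W : U x ->
  (forall N, normal_to h f x N -> ip x W N = 0) ->
  W = tangent_part g h f x W.
Proof.
move=> Ux WN; set T := tangent_part g h f x W.
have N0 : normal_to h f x (W - T).
  by move=> c; rewrite innerBl (tangent_part_inner Hg iso) // subrr.
apply/subr0_eq/eqP/negPn/negP => /(metric_on_pos Hh (UV Ux)).
by rewrite innerBl (WN _ N0) (tangent_normal Hh Hf _ N0 Ux) subrr ltxx.
Qed.

(** The tension field is the trace of the second fundamental form. *)
Lemma shape_tension_trace x : U x ->
  \tr (G x *m shape_mx h f tau x) = ip x (tau x) (tau x).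
Proof.
move=> Ux; rewrite [X in _ = inner _ _ _ X](tensionE (g := g)) inner_sumr.
apply: eq_bigr => a _.
rewrite inner_sumr mxE; apply: eq_bigr => b _; rewrite innerZr; congr (_ * _).
rewrite mxE (cov_torsion_free Hh Hf 'e_b 'e_a Ux) second_fundamental_formE.
rewrite [RHS]innerBr inner_sumr [X in _ - X]big1 ?subr0// => k _.
by rewrite innerZr (tension_normal Hh Hg Hf iso Ux) mulr0.
Qed.

Hypothesis m_gt0 : (0 < m)%N.
Hypothesis pmc : forall x a, U x ->
  nabla_perp g h f a (mean_curvature g h f) x = 0.

(** The hypothesis bears on the mean curvature, which is the tension field
    divided by the dimension. *)
Lemma tension_parallel x a W : U x -> normal_to h f x W ->
  ip x (nab a tau x) W = 0.
Proof.
move=> Ux WN; have := pmc a Ux; rewrite /nabla_perp nabla_alongE.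
have -> : mean_curvature g h f = fun x => m%:R^-1 *: tau x by [].
have sc : smooth_on U (fun _ : 'rV[R]_m => m%:R^-1 : R) by exact: smooth_cst.
rewrite (cov_scale Hf 'e_a sc (smooth_tension Hh Hg Hf) Ux) derive_cst scale0r add0r.
move=> /subr0_eq E; have := tangent_normal Hh Hf (m%:R^-1 *: nab a tau x) WN Ux (g := g).
rewrite -E innerZl => /eqP; rewrite mulf_eq0 invr_eq0 pnatr_eq0.
rewrite -[m == 0%N]negbK -lt0n m_gt0.
by move=> /eqP.
Qed.

(** The rough Laplacian and the curvature term of the bitension field have the
    same tangential part. *)
Lemma bitension_tangent x c : U x ->
  ip x (bitension g h f x) (F c x) =
  2 * \sum_a \sum_b G x a b * riem h (f x) (F a x) (F c x) (tau x) (F b x).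
Proof.
move=> Ux.
have T1 := trace_nabla2_tangent Hh Hg Hf iso (smooth_tension Hh Hg Hf)
  (@tension_normal _ _ _ _ _ _ _ _ Hh Hg Hf iso) tension_parallel shape_tension_trace c Ux.
have T2 := trace_curvature_term Hh Hg Hf tau c Ux.
rewrite /bitension /laplacian_along opprK innerBl /trace_wrt !inner_suml.
transitivity (\sum_a \sum_b G x a b * ip x (hessian_along g h f tau a b x) (F c x)
  - \sum_a \sum_b G x a b * riem h (f x) (F a x) (tau x) (F b x) (F c x)).
  congr (_ - _); apply: eq_bigr => a _; rewrite inner_suml; apply: eq_bigr => b _.
    by rewrite innerZl hessian_alongE.
  by rewrite innerZl riem.unlock.
have twice (p q r : R) : p = r -> q = - r -> p - q = 2 * r by move=> -> ->; ring.
exact: twice T1 T2.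
Qed.

Lemma biconservative_at x : U x ->
  tangent_part g h f x (bitension g h f x) = 0 <->
  forall c, \sum_a \sum_b G x a b * riem h (f x) (F a x) (F c x) (tau x) (F b x) = 0.
Proof.
move=> Ux; rewrite (tangent_part_eq0 Hg iso _ Ux); split=> H c.
  by have /eqP := H c; rewrite bitension_tangent// mulf_eq0 pnatr_eq0 => /eqP.
by rewrite bitension_tangent// H mulr0.
Qed.

End Reduction.

(** * Surfaces in complex space forms *)
Lemma sum_sym_antisym (R : realType) n (A B : 'I_n -> 'I_n -> R) :
  (forall a b, A a b = A b a) -> (forall a b, B a b = - B b a) ->
  \sum_a \sum_b A a b * B a b = 0.
Proof.
move=> sA aB; set S := (X in X = 0); suff : S = - S by lra.
rewrite {1}/S exchange_big -sumrN; apply: eq_bigr => b _ /=.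
by rewrite -sumrN; apply: eq_bigr => a _; rewrite sA aB mulrN.
Qed.

(** The pull-back by [f] of the fundamental form of the ambient space. *)
Definition kahler_form (R : realType) m d (h : 'rV[R]_d -> 'M[R]_d)
    (f : 'rV[R]_m -> 'rV[R]_d) (J : 'M[R]_d) x (a b : 'I_m) : R :=
  inner h (f x) ('D_('e_a) f x *m J) ('D_('e_b) f x).

(** Minus the covariant components of the tangential part of [tau *m J]. *)
Definition J_tau (R : realType) m d (h : 'rV[R]_d -> 'M[R]_d)
    (f : 'rV[R]_m -> 'rV[R]_d) (J : 'M[R]_d) (tau : 'rV[R]_m -> 'rV[R]_d) x
    (a : 'I_m) : R :=
  inner h (f x) ('D_('e_a) f x *m J) (tau x).

Section TotallyReal.
Context {R : realType} {m d : nat} {V : set 'rV[R]_d} {U : set 'rV[R]_m}.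
Context {h : 'rV[R]_d -> 'M[R]_d} {g : 'rV[R]_m -> 'M[R]_m}.
Context {f : 'rV[R]_m -> 'rV[R]_d} {J : 'M[R]_d} {c : R}.
Hypothesis HK : kahler_on V h J.
Hypothesis holc : forall z, V z -> forall X : 'rV[R]_d, X != 0 ->
  sectional_curvature h z X (X *m J) = c.
Hypothesis Hg : metric_on U g.
Hypothesis Hf : smooth_map U V f.
Hypothesis iso : forall x, U x -> forall X Y : 'rV[R]_m,
  inner h (f x) ('D_X f x) ('D_Y f x) = inner g x X Y.
Let Hh := kahler_on_metric HK.
Let oU := metric_on_open Hg.
Let UV := smooth_map_sub Hf.
Let sF := smooth_frame Hg Hf.
Local Notation F a := ('D_('e_a) f).
Local Notation ip x := (inner h (f x)).
Local Notation nab a := (cov h f 'e_a).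
Local Notation G x := (invmx (g x)).
Implicit Types (x : 'rV[R]_m) (a b k l : 'I_m) (W : 'rV[R]_d).

Local Notation w := (kahler_form h f J).

Lemma kahler_form_antisym x a b : U x -> w x a b = - w x b a.
Proof.
move=> Ux; apply: etrans (inner_Jl HK _ _ (UV Ux)) _.
exact: congr1 (inner_sym Hh _ _ (UV Ux)).
Qed.

Lemma smooth_kahler_form a b : smooth_on U (fun x => w x a b).
Proof.
apply: (smooth_inner Hh Hf _ (sF b)).
exact: (smooth_mulmx oU (sF a) (smooth_cst J)).
Qed.

Lemma totally_real_at x : U x ->
  (forall X, normal_bundle h f x ('D_X f x *m J)) <-> (forall a b, w x a b = 0).
Proof.
move=> Ux; have df := smooth_differentiable (smooth_map_smooth Hf) Ux.
split=> [H a b|w0 X Y]; first exact: H.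
rewrite (derive_sum_basis Y df) inner_sumr big1 // => b _; rewrite innerZr.
rewrite (derive_sum_basis X df) mulmx_suml inner_suml big1 ?mulr0// => a _.
by rewrite -scalemxAl innerZl -/(w x a b) w0 mulr0.
Qed.

Variable tau : 'rV[R]_m -> 'rV[R]_d.
Hypothesis tau_smooth : smooth_on U tau.
Hypothesis tau_normal : forall x, U x -> normal_to h f x (tau x).
Local Notation t := (J_tau h f J tau).

(** Only the terms of the curvature tensor that involve [J] survive, as [tau]
    is orthogonal to the frame. *)
Lemma riem_frame x a b k : U x ->
  riem h (f x) (F a x) (F k x) (tau x) (F b x) =
  c / 4 * (t x k * w x a b + t x a * w x b k + 2 * (t x b * w x a k)).
Proof.
move=> Ux; rewrite (riem_space_form HK holc _ _ _ _ (UV Ux)) /space_form_tensor.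
have normal e : ip x (F e x) (tau x) = 0.
  by rewrite (inner_sym Hh _ _ (UV Ux)); exact: tau_normal.
have Jtau : ip x (tau x *m J) (F b x) = - t x b.
  apply: etrans (inner_Jl HK _ _ (UV Ux)) _.
  exact: congr1 (inner_sym Hh _ _ (UV Ux)).
have contract (p q y z u ta tb tk wab wkb wak wbk : R) :
    p = 0 -> q = 0 -> u = - tb -> wkb = - wbk ->
    c / 4 * (p * y - q * z + tk * wab - ta * wkb - 2 * wak * u) =
    c / 4 * (tk * wab + ta * wbk + 2 * (tb * wak)).
  by move=> -> -> -> ->; ring.
exact: (contract _ _ _ _ _ _ _ _ _ _ _ _ (normal k) (normal a) Jtau
  (kahler_form_antisym k b Ux)).
Qed.

(** Of the three terms of [riem_frame], the first contracts a symmetric tensor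
    with an antisymmetric one; the third equals twice the second. *)
Lemma curvature_contraction x k : U x ->
  \sum_a \sum_b G x a b * riem h (f x) (F a x) (F k x) (tau x) (F b x) =
  c * (3 / 4) * \sum_a \sum_b G x a b * (t x a * w x b k).
Proof.
move=> Ux; have sG a b := inverse_metric_sym Hg a b Ux.
have S1 := sum_sym_antisym sG (fun a b => kahler_form_antisym a b Ux).
have S2 : \sum_a \sum_b G x a b * (t x b * w x a k) =
          \sum_a \sum_b G x a b * (t x a * w x b k).
  rewrite [LHS]exchange_big; apply: eq_bigr => a _; apply: eq_bigr => b _.
  by congr (_ * _); exact: sG.
have E : \sum_a \sum_b G x a b * riem h (f x) (F a x) (F k x) (tau x) (F b x) =
  c / 4 * t x k * (\sum_a \sum_b G x a b * w x a b)
  + c / 4 * (\sum_a \sum_b G x a b * (t x a * w x b k))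
  + c / 2 * \sum_a \sum_b G x a b * (t x b * w x a k).
  rewrite !mulr_sumr -!big_split; apply: eq_bigr => a _ /=.
  rewrite !mulr_sumr -!big_split; apply: eq_bigr => b _ /=.
  apply: etrans (congr1 _ (riem_frame a b k Ux)) _.
  have expand (G0 p q r : R) : G0 * (c / 4 * (t x k * p + q + 2 * r)) =
    c / 4 * t x k * (G0 * p) + c / 4 * (G0 * q) + c / 2 * (G0 * r) by field.
  exact: expand.
have total (p q r s : R) : p = 0 -> r = q ->
  c / 4 * s * p + c / 4 * q + c / 2 * r = c * (3 / 4) * q by move=> -> ->; field.
exact: etrans E (total _ _ _ _ S1 S2).
Qed.

Hypothesis tau_parallel : forall x a W, U x -> normal_to h f x W ->
  ip x (nab a tau x) W = 0.

(** The complex structure is parallel for the pulled-back connection too. *)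
Lemma covJ x a (A : 'rV[R]_m -> 'rV[R]_d) : smooth_on U A -> U x ->
  nab a (fun y => A y *m J) x = nab a A x *m J.
Proof.
move=> sA Ux; have sJ : smooth_on U (fun _ : 'rV[R]_m => J) by exact: smooth_cst.
rewrite cov.unlock (derive_mulmx oU 'e_a sA sJ Ux) derive_cst mulmx0 addr0.
by rewrite (gammaJ HK _ _ (UV Ux)) mulmxDl.
Qed.

Lemma derive_J_tau x a b : U x -> 'D_('e_b) (fun y => t y a) x =
  ip x (nab b (F a) x *m J) (tau x) + ip x (F a x *m J) (nab b tau x).
Proof.
move=> Ux; have sFJ := smooth_mulmx oU (sF a) (smooth_cst J).
by rewrite (derive_inner_cov Hh Hf 'e_b sFJ tau_smooth Ux) (covJ b (sF a) Ux).
Qed.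

(** The derivatives of [tau] are tangent, and their components are those of the
    shape form. *)
Lemma nabla_tau_shape x b : U x -> nab b tau x =
  - \sum_k \sum_l (G x k l * shape_mx h f tau x b k) *: F l x.
Proof.
move=> Ux.
rewrite [LHS](normal_tangent_part0 Hh Hg Hf iso Ux (fun N => tau_parallel b Ux)).
rewrite /tangent_part /trace_wrt -sumrN; apply: eq_bigr => k _.
rewrite -sumrN; apply: eq_bigr => l _.
rewrite (inner_nabla_frame Hh Hg Hf tau_smooth tau_normal)//.
by rewrite scaleNr scalerN scalerA.
Qed.

End TotallyReal.

Lemma sum_ord2 (V : zmodType) (E : 'I_2 -> V) : \sum_i E i = E 0 + E 1.
Proof. by rewrite big_ord_recl big_ord1; congr (_ + E _); apply: val_inj. Qed.

Lemma all_ord2 (P : 'I_2 -> Prop) : P 0 -> P 1 -> forall i, P i.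
Proof.
move=> P0 P1 i; have [i0|i1] : i = 0 \/ i = 1; last by rewrite i1.
  by case: i => -[|[|//]] ?; [left|right]; apply: val_inj.
by rewrite i0.
Qed.

(** The matrix identity behind [kahler_form01_eq0]: an antisymmetric form in
    dimension 2 is a multiple of the area form, and contracting a product with
    it yields a trace. *)
Lemma trace_mul_eq0 (R : realType) (G S : 'M[R]_2) (w : 'I_2 -> 'I_2 -> R) :
  w 0 0 = 0 -> w 1 1 = 0 -> w 1 0 = - w 0 1 ->
  - (\sum_k \sum_l G k l * S 1 k * w 0 l) = - (\sum_k \sum_l G k l * S 0 k * w 1 l) ->
  w 0 1 * \tr (G *m S) = 0.
Proof.
move=> w00 w11 w10; rewrite /mxtrace !sum_ord2 !mxE !sum_ord2 w00 w11 w10.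
by move: (w 0 1) => y E; lra.
Qed.

Section Surface.
Context {R : realType} {d : nat} {V : set 'rV[R]_d} {U : set 'rV[R]_2}.
Context {h : 'rV[R]_d -> 'M[R]_d} {g : 'rV[R]_2 -> 'M[R]_2}.
Context {f : 'rV[R]_2 -> 'rV[R]_d} {J : 'M[R]_d}.
Hypothesis HK : kahler_on V h J.
Hypothesis Hg : metric_on U g.
Hypothesis Hf : smooth_map U V f.
Hypothesis iso : forall x, U x -> forall X Y : 'rV[R]_2,
  inner h (f x) ('D_X f x) ('D_Y f x) = inner g x X Y.
Let Hh := kahler_on_metric HK.
Let oU := metric_on_open Hg.
Let UV := smooth_map_sub Hf.
Local Notation F a := ('D_('e_a) f).
Local Notation ip x := (inner h (f x)).
Local Notation nab a := (cov h f 'e_a).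
Local Notation G x := (invmx (g x)).
Variable tau : 'rV[R]_2 -> 'rV[R]_d.
Hypothesis tau_smooth : smooth_on U tau.
Hypothesis tau_normal : forall x, U x -> normal_to h f x (tau x).
Hypothesis tau_parallel : forall x a W, U x -> normal_to h f x W ->
  ip x (nab a tau x) W = 0.
Local Notation S x := (shape_mx h f tau x).
Hypothesis shape_trace : forall x, U x -> \tr (G x *m S x) = ip x (tau x) (tau x).
Local Notation w := (kahler_form h f J).
Local Notation t := (J_tau h f J tau).
Implicit Types (x : 'rV[R]_2) (a b k l : 'I_2).

(** In dimension 2 a nonzero antisymmetric form is nondegenerate, so the
    contraction vanishes only if the tangential part of [tau *m J] does. *)
Lemma J_tau_eq0 x : U x ->
  (forall k, \sum_a \sum_b G x a b * (t x a * w x b k) = 0) ->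
  w x 0 1 != 0 -> forall a, t x a = 0.
Proof.
move=> Ux H w0.
have w00 a : w x a a = 0.
  by have := kahler_form_antisym HK Hf a a Ux; move: (w _ _ _) => y; lra.
have w10 := kahler_form_antisym HK Hf 1 0 Ux.
pose T : 'rV[R]_2 := \row_a t x a.
have TG k : (T *m G x) 0 0 * w x 0 k + (T *m G x) 0 1 * w x 1 k = 0.
  rewrite -(sum_ord2 (fun b => (T *m G x) 0 b * w x b k)) -[RHS](H k).
  rewrite [RHS]exchange_big; apply: eq_bigr => b _ /=; rewrite !mxE mulr_suml.
  by apply: eq_bigr => a _; rewrite mxE mulrCA mulrA.
have T0 : T *m G x = 0.
  apply/rowP; apply: all_ord2.
    rewrite [RHS]mxE; have := TG 1; rewrite w00 mulr0 addr0 => /eqP.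
    by rewrite mulf_eq0 (negbTE w0) orbF => /eqP.
  rewrite [RHS]mxE; have := TG 0; rewrite w00 mulr0 add0r w10 => /eqP.
  by rewrite mulf_eq0 oppr_eq0 (negbTE w0) orbF => /eqP.
move=> a; have : T = 0.
  by rewrite -(mulmxKV (metric_unit Hg Ux) T) T0 mul0mx.
by move=> /rowP/(_ a); rewrite !mxE.
Qed.

Lemma inner_FJ_nabla_tau x a b : U x ->
  ip x (F a x *m J) (nab b tau x) =
  - \sum_k \sum_l G x k l * S x b k * w x a l.
Proof.
move=> Ux; rewrite (nabla_tau_shape HK Hg Hf iso tau_smooth tau_normal tau_parallel b Ux).
rewrite innerNr inner_sumr; congr (- _); apply: eq_bigr => k _.
by rewrite inner_sumr; apply: eq_bigr => l _; rewrite innerZr.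
Qed.

(** If the form did not vanish at [x], it would not vanish near [x], and
    [tau *m J] would be normal near [x]. Differentiate this relation and
    antisymmetrize: the derivatives of the frame are symmetric and drop out,
    the derivatives of [tau] are given by the shape form, and what remains is
    the Kaehler form times the trace of the shape form, that is, times the
    squared length of [tau]. *)
Lemma kahler_form01_eq0 x : U x -> tau x != 0 ->
  (forall y, U y -> forall k, \sum_a \sum_b G y a b * (t y a * w y b k) = 0) ->
  w x 0 1 = 0.
Proof.
move=> Ux tau0 H; apply/eqP/negPn/negP => w0.
have sw := smooth_kahler_form HK Hg Hf 0 1.
have near_t a : \forall y \near x, t y a = 0.
  have nU : \forall y \near x, U y by exact: open_nbhs_nbhs.
  have nw : \forall y \near x, w y 0 1 != 0.
    have cw := differentiable_continuous (smooth_differentiable sw Ux).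
    exact: (cvgr_neq0 _ cw w0).
  by apply: filterS2 nU nw => y Uy wy; exact: (J_tau_eq0 Uy (H _ Uy) wy).
have Dt a b : ip x (nab b (F a) x *m J) (tau x) + ip x (F a x *m J) (nab b tau x) = 0.
  rewrite -(derive_J_tau HK Hg Hf tau_smooth a b Ux).
  by rewrite (near_eq_derive 'e_b (g := fun _ => 0)) ?derive_cst//; exact: near_t.
have w00 a : w x a a = 0.
  by have := kahler_form_antisym HK Hf a a Ux; move: (w _ _ _) => y; lra.
have w10 := kahler_form_antisym HK Hf 1 0 Ux.
have E : ip x (F 0 x *m J) (nab 1 tau x) = ip x (F 1 x *m J) (nab 0 tau x).
  have E1 := Dt 0 1; have E2 := Dt 1 0.
  rewrite (cov_torsion_free Hh Hf 'e_1 'e_0 Ux) in E1.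
  by apply: (addrI (ip x (nab 0 (F 1) x *m J) (tau x))); rewrite E1 E2.
have EE := etrans (esym (inner_FJ_nabla_tau 0 1 Ux)) (etrans E (inner_FJ_nabla_tau 1 0 Ux)).
have := trace_mul_eq0 (w00 0) (w00 1) w10 EE; rewrite (shape_trace Ux).
have := metric_on_pos Hh (UV Ux) tau0.
move=> pos /eqP; rewrite mulf_eq0 (negbTE w0) /= => /eqP tt0.
by rewrite tt0 ltxx in pos.
Qed.

Lemma kahler_form_eq0 x : U x -> tau x != 0 ->
  (forall y, U y -> forall k, \sum_a \sum_b G y a b * (t y a * w y b k) = 0) ->
  forall a b, w x a b = 0.
Proof.
move=> Ux tau0 H; have w01 := kahler_form01_eq0 Ux tau0 H.
have anti := kahler_form_antisym HK Hf _ _ Ux.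
have diag a : w x a a = 0 by have := anti a a; move: (w _ _ _) => y; lra.
apply: all_ord2; apply: all_ord2; [exact: diag|exact: w01| |exact: diag].
by apply: etrans (anti 1 0) _; rewrite w01 oppr0.
Qed.

End Surface.

(** * From charts to manifolds *)
Lemma sub_Ck (R : realType) m (W : normedModType R) k (U U' : set 'rV[R]_m)
    (f : 'rV[R]_m -> W) : U `<=` U' -> Ck k U' f -> Ck k U f.
Proof.
move=> UU'; elim: k f => [|k IH] f /=; first by move=> fc x /UU'; exact: fc.
by move=> [df Df]; split=> [x /UU'|a]; [exact: df|exact: IH].
Qed.

Section Charts.
Context {R : realType} {m d : nat}.

(** All the hypotheses of the local theory hold on these domains, so the
    theorem can be proved in each pair of charts separately. *)
Lemma open_repdom (T S : topologicalType) (u : chart R m T) (v : chart R d S)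
    (phi : T -> S) : continuous phi -> open (repdom u v phi).
Proof.
move=> phic; rewrite openE => x [ux vx]; apply: filterI.
  by apply: open_nbhs_nbhs; split => //; exact: cimg_open.
have cc : {for x, continuous (fun y => phi (cinv u y))}.
  by apply: continuous_comp; [exact: cinv_continuous|exact: phic].
by apply: cc; apply: open_nbhs_nbhs; split => //; exact: cdom_open.
Qed.

Lemma metric_on_chart (N : riemannianManifold R d) (j : chart_index N) :
  metric_on (cimg (atlas j)) (metric j).
Proof.
split; [exact: cimg_open|exact: metric_smooth| |].
  by move=> x Vx; exact: (Defs.metric_sym Vx).
by move=> x Vx; exact: (Defs.metric_pos Vx).
Qed.

Context {M : riemannianManifold R m} {N : riemannianManifold R d} {phi : M -> N}.
Hypothesis phi_immersion : isometric_immersion phi.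

Lemma metric_on_repdom i j :
  metric_on (repdom (atlas i) (atlas j) phi) (metric (r := M) i).
Proof.
have [phic _ _] := phi_immersion.
split; first exact: open_repdom.
- by move=> k; apply: (sub_Ck _ (metric_smooth i k)) => x [].
- by move=> x [Vx _]; exact: (Defs.metric_sym Vx).
- by move=> x [Vx _]; exact: (Defs.metric_pos Vx).
Qed.

Lemma smooth_map_rep i j : smooth_map (repdom (atlas i) (atlas j) phi)
  (cimg (atlas j)) (rep (atlas i) (atlas j) phi).
Proof.
have [phic phis _] := phi_immersion.
split; [exact: open_repdom|exact: phis|].
by move=> x [_ vx]; exists (phi (cinv (atlas i) x)).
Qed.

End Charts.

Lemma stdJ2 (R : realType) n : stdJ R n *m stdJ R n = - 1%:M.
Proof.
rewrite /stdJ mulmx_block !mul0mx !mulmx0 !mul1mx !mulmx1 !add0r !addr0.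
by rewrite (@scalar_mx_block _ n n) opp_block_mx !oppr0.
Qed.

Lemma kahler_on_chart (R : realType) n (N : riemannianManifold R (n + n))
    (j : chart_index N) : kahler N ->
  kahler_on (cimg (atlas j)) (metric j) (stdJ R n).
Proof.
move=> [_ herm closed]; split.
- exact: metric_on_chart.
- exact: stdJ2.
- exact: herm.
- exact: closed.
Qed.

Theorem theorem3p1 (R : realType) (n : nat) (c : R)
    (N : riemannianManifold R (n + n)) (hN : complex_space_form c N)
    (M : riemannianManifold R 2) (hM : oriented M)
    (phi : M -> N) (hphi : isometric_immersion phi)
    (hPMC : PMC phi) (hH : nowhere_vanishing_mean_curvature phi) :
  (c = 0 -> biconservative phi) /\
  (c <> 0 -> (biconservative phi <-> totally_real phi)).
Proof.
have [kN holN] := hN.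
have HK j := kahler_on_chart j kN.
have Hh j := kahler_on_metric (HK j).
have Hg i j := metric_on_repdom hphi i j.
have Hf i j := smooth_map_rep hphi i j.
have [_ _ iso] := hphi.
have taun i j := tension_normal (Hh j) (Hg i j) (Hf i j) (iso i j).
have bic i j x := biconservative_at (Hh j) (Hg i j) (Hf i j) (iso i j)
  (isT : (0 < 2)%N) (fun x a Ux => hPMC i j x Ux a) (x := x).
have contr i j x k := curvature_contraction (HK j) (holN j) (Hg i j) (Hf i j)
  (taun i j) (x := x) k.
split=> [c0 loc dom i j x Ux|c0].
  by apply: (bic i j x Ux).2 => k; rewrite contr// c0 !mul0r.
split=> [bicons i j x Ux|real loc dom i j x Ux]; last first.
  apply: (bic i j x Ux).2 => k; rewrite contr//.
  have /(totally_real_at (Hf i j) Ux) w0 := real i j x Ux.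
  by rewrite big1 ?mulr0// => a _; rewrite big1// => b _; rewrite w0 !mulr0.
have tau_par i' j' x' a W := tension_parallel (Hh j') (Hg i' j') (Hf i' j')
  (isT : (0 < 2)%N) (fun y b Uy => hPMC i' j' y Uy b) (x := x') a (W := W).
have tau0 : tension (metric i) (metric j) (rep (atlas i) (atlas j) phi) x != 0.
  by have := hH i j x Ux; apply: contra => /eqP t0; rewrite /mean_curvature
    -/(tension _ _ _ _) t0 scaler0.
apply/(totally_real_at (Hf i j) Ux).
apply: (kahler_form_eq0 (HK j) (Hg i j) (Hf i j) (iso i j)
  (smooth_tension (Hh j) (Hg i j) (Hf i j)) (taun i j) (tau_par i j)
  (shape_tension_trace (Hh j) (Hg i j) (Hf i j) (iso i j)) Ux tau0) => y Uy k.
have := contr i j y k Uy.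
rewrite ((bic i j y Uy).1 (bicons i j y Uy) k) => /esym/eqP.
rewrite mulf_eq0 mulf_eq0 (negbTE (introN eqP c0)) /= mulf_eq0 invr_eq0 !pnatr_eq0 /=.
by move=> /eqP.
Qed.
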